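(* Suppose that: (a) for every $x\in\mathbb X$ and every $t>0$, $\mathbb P^x[\max_{s\in[0,t]}X_s>x]=\mathbb P^x[\min_{s\in[0,t]}X_s<x]=1$; (b) for every $x\in\mathbb X$, $\delta(t)f(X^x_t)\to 0$ as $t\to\infty$, $\mathbb P^x$-a.s.; (c) for every $x\in\mathbb X$, $\mathbb E^x\big[\sup_{t\in[0,\infty)}\delta(t)f(X_t)\big]<\infty$. Then for any sequence $(R_n)_{n\in\mathbb N}$ of closed equilibria, $R:=\bigcap_{n\in\mathbb N}R_n$ belongs to $\mathcal E$. Moreover, for each $n\in\mathbb N$, $J(x,R)\ge J(x,R_n)$ for all $x\in\mathbb X$.
   Context: $X=(X_t)_{t\ge 0}$ is a time-homogeneous continuous strong Markov process on a probability space $(\Omega,\mathcal F,\mathbb P)$, taking values in an interval $\mathbb X\subseteq\mathbb R$. $\mathcal B(\mathbb X)$ is the collection of Borel subsets of $\mathbb X$; $\mathbb P^x,\mathbb E^x$ denote probability and expectation given $X_0=x$, and $X^x$ denotes $X$ started at $x\in\mathbb X$. The payoff function $f:\mathbb X\to[0,\infty)$ is continuous. The discount function $\delta:[0,\infty)\to(0,1]$ is non-increasing and continuous, with $\delta(0)=1$, $\delta(t)\to0$ as $t\to\infty$, and is log sub-additive: $\delta(s)\delta(t)\le\delta(s+t)$ for all $s,t>0$. For $x\in\mathbb X$, $R\in\mathcal B(\mathbb X)$: $\rho(x,R):=\inf\{t>0: X^x_t\in R\}$ ($\inf\emptyset=\infty$) and $J(x,R):=\mathbb E^x[\delta(\rho(x,R))f(X_{\rho(x,R)})]$,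 where on $\{\rho(x,R)=\infty\}$ the integrand is taken to be $\limsup_{t\to\infty}\delta(t)f(X^x_t)$. Put $S_R:=\{x: f(x)>J(x,R)\}$, $I_R:=\{x: f(x)=J(x,R)\}$, and $\Theta(R):=S_R\cup(I_R\cap R)$. $R\in\mathcal B(\mathbb X)$ is an equilibrium if $\Theta(R)=R$; $\mathcal E$ is the set of all equilibria. ''Closed'' means closed relative to $\mathbb X$. *)

(* Defs.v *)
From HB Require Import structures.
From mathcomp Require Import all_boot all_order all_algebra.
From mathcomp Require Import all_classical all_reals all_analysis.
From mathcomp Require Import measurable_realfun.
Import Order.TTheory GRing.Theory Num.Theory.
Import numFieldNormedType.Exports.

Set Implicit Arguments.
Unset Strict Implicit.
Unset Printing Implicit Defensive.

Local Open Scope classical_set_scope.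
Local Open Scope ring_scope.
Local Open Scope ereal_scope.

(* The sigma-algebra generated by the real-valued maps Y t, t in I. *)
Definition sigma_gen (R : realType) (U : Type) (Y : R -> U -> R) (I : set R)
    : set_system U :=
  <<s \bigcup_(t in I) preimage_set_system setT (Y t) measurable >>.

(* Paths are total functions R -> R; only their restriction to [0, +oo[ is seen
   by this sigma-algebra, which is the product sigma-algebra of R^[0, +oo[. *)
Definition path_sigma (R : realType) : set_system (R -> R) :=
  sigma_gen (fun t p => p t) `[0%R, +oo[.

Section process.
Context (R : realType) (d : measure_display) (Omega : measurableType d).
Implicit Types (X : R -> Omega -> R) (tau : Omega -> \bar R).

Definition natural_filtration X (t : R) : set_system Omega :=
  sigma_gen X `[0%R, t].

Definition stopping_time X tau : Prop :=
  (forall w, 0 <= tau w) /\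
  (forall t : R, (0 <= t)%R ->
    natural_filtration X t [set w | tau w <= t%:E]).

Definition stopped_sigma X tau : set_system Omega :=
  [set A | sigma_gen X `[0%R, +oo[ A /\
    forall t : R, (0 <= t)%R ->
      natural_filtration X t (A `&` [set w | tau w <= t%:E])].

(* The family (P x), x in D, of laws of X given X_0 = x.  The values of P x for
   x outside D and of X t for t < 0 are irrelevant.  The last field says that,
   on {tau < +oo}, the conditional law under P x of the path (X_(tau + t))_t
   given F_tau is the law of (X_t)_t under P (X_tau). *)
Record continuous_strong_markov (D : set R) (P : R -> probability Omega R) X
    : Prop := {
  csm_measurable : forall t : R, (0 <= t)%R -> measurable_fun setT (X t) ;
  csm_state : forall (t : R) w, (0 <= t)%R -> D (X t w) ;
  csm_continuous : forall w,
    {within `[0%R, +oo[, continuous (fun t : R => X t w)} ;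
  csm_start : forall x, D x -> P x [set w | X 0%R w = x] = 1 ;
  csm_kernel : forall B, @path_sigma R B ->
    measurable_fun D
      (fun x => P x [set w | B (fun t => X t w)]) ;
  csm_strong_markov : forall x tau A B, D x ->
    stopping_time X tau -> stopped_sigma X tau A -> @path_sigma R B ->
    P x (A `&` [set w | tau w < +oo /\
                        B (fun t => X (fine (tau w) + t)%R w)]) =
    \int[P x]_(w in A `&` [set w | tau w < +oo])
      P (X (fine (tau w)) w) [set w' | B (fun t => X t w')]
}.

End process.

Record discount_function (R : realType) (delta : R -> R) : Prop := {
  discount_range : forall t : R, (0 <= t)%R -> (0 < delta t <= 1)%R ;
  discount_nonincreasing : forall s t : R,
    (0 <= s)%R -> (s <= t)%R -> (delta t <= delta s)%R ;
  discount_continuous : {within `[0%R, +oo[, continuous delta} ;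
  discount0 : delta 0%R = 1%R ;
  discount_cvg : delta t @[t --> +oo%R] --> 0%R ;
  discount_log_subadditive : forall s t : R, (0 < s)%R -> (0 < t)%R ->
    (delta s * delta t <= delta (s + t))%R
}.

Section equilibrium.
Context (R : realType) (d : measure_display) (Omega : measurableType d).
Variables (D : set R) (P : R -> probability Omega R) (X : R -> Omega -> R).
Variables (f delta : R -> R).
Implicit Types (A : set R).

Definition hitting_time A (w : Omega) : \bar R :=
  ereal_inf [set t%:E | t in [set t : R | (0 < t)%R /\ A (X t w)]].

Definition discounted_payoff (w : Omega) (t : R) : R :=
  (delta t * f (X t w))%R.

Definition stopped_payoff A (w : Omega) : \bar R :=
  if hitting_time A w is t%:E then (discounted_payoff w t)%:E
  else limf_esup (fun t : R => (discounted_payoff w t)%:E) +oo%R.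

(* For a merely Borel A the (nonnegative) integrand is measurable only with
   respect to the P x-completion; the integral, a supremum over measurable
   simple functions below the integrand, is then the completed one. *)
Definition J (x : R) A : \bar R := \int[P x]_w stopped_payoff A w.

Definition S_ A : set R := [set x | D x /\ J x A < (f x)%:E].

Definition I_ A : set R := [set x | D x /\ (f x)%:E = J x A].

Definition Theta A : set R := S_ A `|` (I_ A `&` A).

(* As D is an interval, its Borel subsets are the Borel sets of R inside D. *)
Definition equilibrium A : Prop :=
  [/\ measurable A, A `<=` D & Theta A = A].

End equilibrium.

(* Main.v *)
(** Fix [n] and a point [x] outside the intersection [R].  From [x], hit the
    closed sets [A_n, A_(m_1), A_(m_2), ...] one after the other, every index
    occurring infinitely often.  Since each [A_m] is an equilibrium,
    [f y <= E^y (delta(sigma) f(X_sigma))] for every [y], with [sigma] the first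
    hitting time of [A_m]; by the strong Markov property and log sub-additivity
    of [delta], one more hit never decreases the expected discounted payoff.
    The hitting times increase to a limit at which, when it is finite, the
    continuous path lies in every [A_m]: this limit is the hitting time of [R],
    and dominated convergence gives [J(x, A_n) <= J(x, R)].  Hypothesis (a)
    gives [J(x, R) = f(x)] for [x] in [R]. *)

Require Import Defs.
From HB Require Import structures.
From mathcomp Require Import all_boot all_order all_algebra.
From mathcomp Require Import all_classical all_reals all_analysis.
From mathcomp Require Import measurable_realfun.
From mathcomp Require Import giry lra.
Import Order.TTheory GRing.Theory Num.Theory.
Import numFieldNormedType.Exports.

Set Implicit Arguments.
Unset Strict Implicit.
Unset Printing Implicit Defensive.

Local Open Scope classical_set_scope.
Local Open Scope ring_scope.
Local Open Scope ereal_scope.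

(** The strong Markov property is assumed for stopping times of the raw filtration and for path
    events in the product sigma-algebra; both restrictions shape the proof. The hitting times in [J]
    look at [t > 0] and need not be stopping times of this filtration, so they are replaced by
    debuts, which also admit the starting time itself. For a start outside the set the two agree
    almost surely; for a start inside, the debut is immediate and its value is [f]. Hence the
    one-step inequality holds at every point of [D], as it must, being applied at the random point
    reached by the previous hit. Debuts are measurable functionals only of continuous paths, so the
    Markov property is carried over to a space of such paths, and from events to integrals by means
    of the Giry monad. Never hitting is given the value [0], which by (b) is almost surely the
    limsup in the definition of [J]; the two integrands are then compared up to null sets. *)

(** * Continuity on the half-line and measurability at random times *)

Lemma continuous_comp_in (R : realType) (A : set R) (g f : R -> R) :
  {within A, continuous f} -> continuous g -> (forall t, A (g t)) ->
  continuous (fun t => f (g t)).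
Proof.
move=> /subspace_continuousP cf cg Ag t.
apply: cvg_comp (cf _ (Ag t)).
move=> U; rewrite /within /= => nU.
have := cg t _ nU; rewrite ?nbhs_simpl /= => H.
by apply: filterS H => s; exact.
Qed.

(** Composing with [Num.max 0] extends a function continuous on the half-line to one continuous on
    the whole line; this is the origin of every [Num.max 0] below. *)
Lemma continuous_maxr0 (R : realType) (g : R -> R) :
  {within `[0%R, +oo[, continuous g} -> continuous (fun t : R =>
    g (Num.max 0 t)%R).
Proof.
move=> cg; apply: (continuous_comp_in cg).
  by move=> t; apply: (@continuous_max _ _ (cst 0%R) id);
    [exact: cvg_cst|exact: cvg_id].
by move=> t; rewrite /= in_itv/= andbT le_max lexx.
Qed.

Lemma cvg_floor_divn (R : realType) (s : R) :
  ((Num.floor (s * n.+1%:R))%:~R / n.+1%:R : R)%R @[n --> \oo] --> s.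
Proof.
apply/cvgrPdist_le => e e0.
have := cvg_harmonic (R := R) => /cvgrPdist_le/(_ _ e0).
apply: filterS => n; rewrite sub0r normrN /= ger0_norm ?invr_ge0// => ne.
have /andP[h1 h2] := floor_itv (s * n.+1%:R).
have n0 : (0 < n.+1%:R :> R)%R by [].
rewrite ger0_norm ?subr_ge0 ?ler_pdivrMr//; apply: le_trans ne.
rewrite lerBlDr -(ler_pM2r n0) mulrDl mulVf ?gt_eqF// mulfVK ?gt_eqF//.
by rewrite addrC; move: h2; rewrite intrD => /ltW.
Qed.

Lemma measurable_floor_index (R : realType) d (T : measurableType d)
    (F : int -> T -> R) (s : T -> R) :
  (forall z, measurable_fun setT (F z)) -> measurable_fun setT s ->
  measurable_fun setT (fun w => F (Num.floor (s w)) w).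
Proof.
move=> mF ms _ U mU; rewrite setTI.
have -> : (fun w => F (Num.floor (s w)) w) @^-1` U = \bigcup_(z : int)
    (s @^-1` `[z%:~R, (z + 1)%:~R[ `&` F z @^-1` U).
  apply/seteqP; split=> w /=.
    by move=> FU; exists (Num.floor (s w)) => //=; rewrite in_itv/= floor_itv.
  by case=> z _ [/=]; rewrite in_itv/= => /floor_def ->.
apply: countable_bigcupT_measurable => // z; apply: measurableI.
  by rewrite -[X in measurable X]setTI; exact: ms.
by rewrite -[X in measurable X]setTI; exact: mF.
Qed.

(** Rounded down to a grid of mesh [1 / n.+1], [s] takes countably many values, so the sampled
    process is measurable; by continuity of the paths it converges to the process at [s]. *)
Lemma measurable_random_time (R : realType) d (T : measurableType d)
    (Y : R -> T -> R) (s : T -> R) :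
  (forall t, measurable_fun setT (Y t)) -> (forall w, continuous (Y ^~ w)) ->
  measurable_fun setT s -> measurable_fun setT (fun w => Y (s w) w).
Proof.
move=> mY cY ms.
pose h n w := Y ((Num.floor (s w * n.+1%:R)%R)%:~R / n.+1%:R)%R w.
apply: (measurable_fun_cvg (h := h)) => [n|w _].
  apply: (measurable_floor_index (F := fun z => Y (z%:~R / n.+1%:R)%R)) => //.
  exact: measurable_funM.
apply: (cvg_comp (fun n =>
  (Num.floor (s w * n.+1%:R)%R)%:~R / n.+1%:R)%R (Y ^~ w)).
  exact: cvg_floor_divn.
exact: cY.
Qed.

(** * Debuts of closed sets and stopping times of the raw filtration *)

(** The witness is the distance to [C], which is 1-Lipschitz. The empty set is treated apart because
    [inf set0] is [0], which would make every point a zero. *)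
Lemma closed_zero_set (R : realType) (C : set R) : closed C ->
  exists h : R -> R, [/\ continuous h, forall y, (0 <= h y)%R &
    forall y, h y = 0%R <-> C y].
Proof.
move=> cC; have [->|C0] := eqVneq C set0.
  exists (cst 1%R); split => //; first by move=> ?; exact: cvg_cst.
  by move=> y; split => // /eqP; rewrite oner_eq0.
have /set0P[c Cc] := C0.
pose S y := [set `|y - a|%R | a in C].
have S0 y : S y !=set0 by exists `|y - c|%R, c.
have lS y : lbound (S y) 0%R by move=> _ [a _ <-].
have lS' y : has_lbound (S y) by exists 0%R.
exists (fun y => inf (S y)).
have Sge y : (0 <= inf (S y))%R by apply: lb_le_inf.
have Slip x y : (inf (S x) <= `|x - y| + inf (S y))%R.
  rewrite -lerBlDl; apply: lb_le_inf => // _ [a Ca <-].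
  rewrite lerBlDl; apply: le_trans (ler_distD y _ _).
  by apply: ge_inf => //; exists a.
split => //.
  move=> x; apply/cvgrPdist_le => e e0; near=> y.
  apply: (@le_trans _ _ `|x - y|%R).
    rewrite ler_norml; have := Slip x y; have := Slip y x; rewrite distrC => *;
      apply/andP; split; lra.
  by near: y; apply: cvgr_dist_le => //; exact: cvg_id.
move=> y; split => [Sy0|Cy]; last first.
  apply/eqP; rewrite eq_le Sge andbT; apply: ge_inf => //.
  by exists y => //; rewrite subrr normr0.
apply: cC => U /nbhs_ballP[e /= e0 yeU].
have [_ [a Ca <-]] := inf_adherent e0 (conj (S0 y) (lS' y)).
rewrite Sy0 add0r => yae; exists a; split => //.
exact: yeU.
Unshelve. all: by end_near. Qed.

Section stopping.
Context (R : realType) d (T : measurableType d) (X : R -> T -> R).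
Hypothesis mX : forall t : R, (0 <= t)%R -> measurable_fun setT (X t).
Hypothesis cX : forall w, {within `[0%R, +oo[, continuous (fun t : R => X t w)}.
Implicit Types (tau : T -> \bar R) (C : set R).

(* Starting at [tau] inclusive makes this a stopping time of the raw filtration
   for closed [C], which [hitting_time] is not. *)
Definition debut tau C w : \bar R :=
  ereal_inf [set t%:E | t in [set t : R | tau w <= t%:E /\ C (X t w)]].

Let cXm w : continuous (fun t : R => X (Num.max 0%R t) w).
Proof. exact: (continuous_maxr0 (@cX w)). Qed.

Lemma debut_ge tau C w : tau w <= debut tau C w.
Proof. by apply: le_ereal_inf_tmp => _ [t [taut _] <-]. Qed.

Lemma debut_lb tau C w t : tau w <= t%:E -> C (X t w) -> debut tau C w <= t%:E.
Proof. by move=> taut Ct; apply: ereal_inf_lbound; exists t. Qed.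

(** Admissible times come arbitrarily close to the infimum from above, and the times at which a
    continuous path lies in a closed set form a closed set. *)
Lemma debut_attained tau C w t : closed C -> 0 <= tau w ->
  debut tau C w = t%:E -> C (X t w).
Proof.
move=> cC tau0 dt.
have taut : tau w <= t%:E by rewrite -dt debut_ge.
have t0 : (0 <= t)%R by rewrite -lee_fin; exact: le_trans taut.
have cl : closed ((fun t : R => X (Num.max 0%R t) w) @^-1` C).
  exact: (continuous_closedP (fun t : R =>
    X (Num.max 0%R t) w)).1 (@cXm w) _ cC.
rewrite -[t](max_idPr t0); apply: cl => U /nbhs_ballP[e /= e0 teU].
have dfin : debut tau C w \is a fin_num by rewrite dt.
have [_ [s [taus Cs] <-]] := lb_ereal_inf_adherent e0 dfin.
rewrite -/(debut tau C w) dt -EFinD lte_fin => ste.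
have ts : (t <= s)%R by rewrite -lee_fin -dt debut_lb.
exists s; split => /=; first by rewrite (max_idPr (le_trans t0 ts)).
by apply: teU; rewrite /ball/= distrC ger0_norm ?subr_ge0// ltrBlDl.
Qed.

Lemma debut_leP tau C w t : closed C -> 0 <= tau w -> debut tau C w <= t%:E <->
  exists s : R, [/\ tau w <= s%:E, (s <= t)%R & C (X s w)].
Proof.
move=> cC tau0; split => [|[s [taus st Cs]]]; last first.
  by rewrite (le_trans (debut_lb taus Cs))// lee_fin.
case dE : (debut tau C w) => [s| |]//=; last first.
  by have := le_trans tau0 (debut_ge tau C w); rewrite dE.
rewrite lee_fin => st; exists s; split => //; first by rewrite -dE debut_ge.
exact: debut_attained dE.
Qed.

Let clip (t : R) (q : rat) : R := Num.min t (Num.max 0%R (ratr q)).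

(* By compactness of [[tau, t]], a path that gets arbitrarily close to [C] at
  the
   times [clip t q] meets [C];
     the times are clipped so that [t] is among them. *)
Lemma debut_le_setE tau C (h : R -> R) (t : R) : (0 <= t)%R ->
  (forall w, 0 <= tau w) -> continuous h -> (forall y, (0 <= h y)%R) ->
  (forall y, h y = 0%R <-> C y) -> closed C ->
  [set w | debut tau C w <= t%:E] =
  \bigcap_(k : nat) \bigcup_(q : rat) ([set w | tau w <= (clip t q)%:E] `&`
    X (clip t q) @^-1` [set y | (h y < k.+1%:R^-1)%R]).
Proof.
move=> t0 tau0 ch h0 hC cC; apply/seteqP; split => w /=.
  move=> /(debut_leP _ cC (tau0 w))[s [taus st Cs]] k _.
  have s0 : (0 <= s)%R by rewrite -lee_fin; exact: le_trans taus.
  have /hC hs := Cs.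
  have k0 : (0 < k.+1%:R^-1 :> R)%R by rewrite invr_gt0.
  have [ts|st'] := leP t s.
    have ste : s = t by apply/eqP; rewrite eq_le st.
    have [q] : exists q : rat, ratr q \in `]t, (t + 1)%R[ by apply:
      rat_in_itvoo; rewrite ltrDl.
    rewrite in_itv/= => /andP[tq _].
    have cq : clip t q = t.
      by rewrite /clip (max_idPr _) ?(min_idPl _)// ltW// (le_lt_trans t0).
    by exists q => //=; rewrite cq -ste hs.
  have cg : continuous (fun u : R => h (X (Num.max 0%R u) w)).
    by move=> u; apply: continuous_comp; [exact: cXm|exact: ch].
  have : nbhs s [set u : R | (h (X (Num.max 0 u) w) < k.+1%:R^-1)%R].
    by apply: (cvgr_lt _ (cg s)); rewrite (max_idPr s0) hs.
  move=> /nbhs_ballP[e /= e0 se].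
  have [q] : exists q : rat, ratr q \in `]s, Num.min t (s + e)%R[.
    by apply: rat_in_itvoo; rewrite lt_min st' ltrDl.
  rewrite in_itv/= lt_min => /andP[sq /andP[qt qse]].
  have q0 : (0 <= ratr q :> R)%R by rewrite (le_trans s0)// ltW.
  have cq : clip t q = ratr q.
    by rewrite /clip (max_idPr _)// (min_idPr _)// ltW.
  exists q => //=; rewrite cq; split.
    by rewrite (le_trans taus)// lee_fin ltW.
  have := se (ratr q); rewrite /= (max_idPr q0); apply.
  by rewrite /ball/= ltr0_norm ?opprB; lra.
move=> H.
have [q0 _ /= [tq0 _]] := H 0%N I.
have clipt q : (clip t q <= t)%R by rewrite /clip ge_min lexx.
case tauE : (tau w) => [a| |]//=; last 2 first.
- by rewrite tauE in tq0.
- by have := tau0 w; rewrite tauE.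
have a0 : (0 <= a)%R by rewrite -lee_fin -tauE.
have at_ : (a <= t)%R.
  by rewrite tauE lee_fin in tq0; exact: le_trans (clipt q0).
have cg : continuous (fun u : R => h (X (Num.max 0%R u) w)).
  by move=> u; apply: continuous_comp; [exact: cXm|exact: ch].
have [c /[!in_itv]/= /andP[ac ct] cmin] := EVT_min at_ (continuous_subspaceT
  cg).
apply/(debut_leP _ cC (tau0 w)); exists c; split => //;
  first by rewrite tauE lee_fin.
have c0 : (0 <= c)%R by exact: le_trans ac.
apply/hC/eqP; rewrite eq_le h0 andbT; apply/ler_addgt0Pl => e e0.
have [k ke] : exists k : nat, (k.+1%:R^-1 < e)%R.
  by have [k _ /(_ k (leqnn k))] := near_infty_natSinv_lt (PosNum e0); exists k.
rewrite addr0; apply: ltW; apply: le_lt_trans ke.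
have [q _ /= [tq hq]] := H k I.
have ct0 : (0 <= clip t q)%R by rewrite le_min t0 le_max lexx.
have := cmin (clip t q); rewrite /= in_itv/= clipt (max_idPr c0) (max_idPr ct0).
by rewrite tauE lee_fin in tq; rewrite tq => /(_ isT)/le_trans; apply;
  apply: ltW.
Qed.

Lemma filtration_mono (s t : R) : (s <= t)%R ->
  natural_filtration X s `<=` natural_filtration X t.
Proof.
move=> st; apply: sub_smallest2r; first exact: smallest_sigma_algebra.
move=> B [u /=].
rewrite in_itv/= => /andP[u0 us] uB; exists u => //=.
by rewrite in_itv/= u0 (le_trans us).
Qed.

Lemma filtration_sub_gen (t : R) :
  natural_filtration X t `<=` sigma_gen X `[0%R, +oo[.
Proof.
apply: sub_smallest2r; first exact: smallest_sigma_algebra.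
move=> B [u /=].
by rewrite in_itv/= => /andP[u0 us] uB; exists u => //=; rewrite in_itv/= u0.
Qed.

Lemma filtration_preimage (s t : R) (B : set R) : (0 <= s <= t)%R ->
  measurable B -> natural_filtration X t (X s @^-1` B).
Proof.
move=> st mB; apply: sub_sigma_algebra; exists s => //=.
by exists B => //; rewrite setTI.
Qed.

Lemma sub_filtration_measurable (t : R) :
  natural_filtration X t `<=` (@measurable _ T).
Proof.
apply: smallest_sub; first exact: sigma_algebra_measurable.
move=> A [s /= ]; rewrite in_itv/= => /andP[s0 _] [B mB <-].
exact: mX.
Qed.

(** Every event in the decomposition of [debut_le_setE] concerns a time [clip t q], which is at most
    [t], and so belongs to the natural filtration at [t]. *)
Lemma debut_stopping tau C : closed C -> stopping_time X tau ->
  stopping_time X (debut tau C).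
Proof.
move=> cC [tau0 stau]; split => [w|t t0];
  first exact: le_trans (debut_ge _ _ _).
have [h [ch h0 hC]] := closed_zero_set cC.
rewrite (debut_le_setE t0 tau0 ch h0 hC cC).
apply: (@bigcapT_measurable _ (g_sigma_algebraType
  (\bigcup_(s in `[0%R, t]) preimage_set_system setT (X s) measurable))) => k.
apply: countable_bigcupT_measurable => // q.
have ct0 : (0 <= clip t q)%R by rewrite le_min t0 le_max lexx.
have ctt : (clip t q <= t)%R by rewrite /clip ge_min lexx.
apply: measurableI; first exact: filtration_mono ctt _ (stau _ ct0).
apply: filtration_preimage; first by rewrite ct0.
rewrite -[X in measurable X]setTI (_ : mkset _ = h @^-1` `]-oo, (k.+1%:R^-1 :
  R)%R[%classic).
  exact: continuous_measurable_fun.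
by apply/seteqP; split => y /=; rewrite in_itv.
Qed.

Lemma stopping_measurable tau : stopping_time X tau -> measurable_fun setT tau.
Proof.
move=> [tau0 stau].
apply: (measurability _ (ErealGenOInfty.measurableE R)) => _ [_ [r ->] <-].
rewrite setTI (_ : _ @^-1` _ = ~` [set w | tau w <= r%:E]); last first.
  by apply/seteqP; split => w /=; rewrite in_itv/= andbT ltNge => /negP.
apply: measurableC; have [r0|r0] := leP 0%R r.
  exact: (@sub_filtration_measurable r _ (stau _ r0)).
rewrite (_ : mkset _ = set0)//; apply/seteqP; split => // w /= tr.
by have := le_trans (tau0 w) tr; rewrite lee_fin leNgt r0.
Qed.

Lemma stopping_time0 : stopping_time X (cst 0).
Proof.
split => // t t0 /=.
have -> : [set w : T | 0%E <= t%:E] = setT.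
  by apply/seteqP; split => // w _ /=; rewrite lee_fin.
exact: (@measurableT _ (g_sigma_algebraType
  (\bigcup_(s in `[0%R, t]) preimage_set_system setT (X s) measurable))).
Qed.

Lemma stopped_sigma_measurable tau A : stopped_sigma X tau A -> measurable A.
Proof.
move=> [gA _]; apply: (smallest_sub _ _ gA);
  first exact: sigma_algebra_measurable.
by move=> E [s /=]; rewrite in_itv/= andbT => s0 [B mB <-]; exact: mX.
Qed.

(** These slices, on which [tau] is almost constant, serve to discretise the discount factor. The
    left end may be negative, so that one slice can contain [tau = 0]. *)
Lemma stopped_sigma_itv tau (a b : R) : stopping_time X tau -> (0 <= b)%R ->
  stopped_sigma X tau [set w | a%:E < tau w <= b%:E].
Proof.
move=> stau b0.
have le_nf (c t : R) : (0 <= t)%R -> natural_filtration X t [set w | tau w <=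
  (Num.min c t)%:E].
  move=> t0; have [c0|c0] := leP 0%R c.
    have mt : (Num.min c t <= t)%R by rewrite ge_min lexx orbT.
    by apply: (filtration_mono mt); apply: stau.2; rewrite le_min c0.
  rewrite (_ : mkset _ = set0); first exact: sigma_algebra0.
  apply/seteqP; split => // w /= /(le_trans (stau.1 w)).
  by rewrite lee_fin le_min leNgt c0.
have itvE (a' b' : R) : [set w | a'%:E < tau w <= b'%:E] =
    [set w | tau w <= b'%:E] `\` [set w | tau w <= a'%:E].
  apply/seteqP; split => w /=; first by move=> /andP[ta ->]; rewrite leNgt ta.
  by move=> [-> /negP]; rewrite -ltNge => ->.
split.
  rewrite itvE; apply: (@measurableD _ (g_sigma_algebraType
    (\bigcup_(s in `[0%R, +oo[) preimage_set_system setT (X s) measurable))).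
    exact: filtration_sub_gen (stau.2 _ b0).
  have [a0|a0] := leP 0%R a; first exact: filtration_sub_gen (stau.2 _ a0).
  rewrite (_ : [set w | tau w <= a%:E] = set0)//.
  apply/seteqP; split => // w /= /(le_trans (stau.1 w)).
  by rewrite lee_fin leNgt a0.
move=> t t0; rewrite (_ : _ `&` _ =
    [set w | tau w <= (Num.min b t)%:E] `\` [set w | tau w <= (Num.min a
      t)%:E]).
  apply: (@measurableD _ (g_sigma_algebraType
    (\bigcup_(s in `[0%R, t]) preimage_set_system setT (X s) measurable)));
      exact: le_nf.
apply/seteqP; split => w /=; rewrite !EFin_min !le_min.
  by move=> [/andP[ta ->] ->]; split=> //; rewrite leNgt ta.
by move=> [/andP[-> tt] /negP]; rewrite negb_and tt orbF -ltNge => ->.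
Qed.

End stopping.

(** * Restriction of a probability to an event *)

Lemma ge0_integral_mrestr (R : realType) d (T : measurableType d)
    (mu : {measure set T -> \bar R}) (A : set T) (mA : measurable A)
    (f : T -> \bar R) :
  measurable_fun setT f -> (forall w, 0 <= f w) ->
  \int[mrestr mu mA]_w f w = \int[mu]_(w in A) f w.
Proof.
move=> mf f0.
rewrite (@ge0_negligible_integral _ _ _ _ setT (~` A))//; last 2 first.
- exact: measurableC.
- by rewrite /= /mrestr setICl measure0.
rewrite setTD setCK; apply: eq_measure_integral => B mB BA.
by rewrite /= /mrestr setIidl.
Qed.

Section mrestr_subprobability.
Context (R : realType) d (T : measurableType d).
Variables (P : probability T R) (A : set T) (mA : measurable A).

Let mrestr_setT : mrestr P mA setT <= 1.
Proof. by rewrite /mrestr setTI probability_le1. Qed.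

HB.instance Definition _ :=
  Measure_isSubProbability.Build _ _ _ (mrestr P mA) mrestr_setT.

(** Left unnormalised, the restriction is a sub-probability, hence a point of the Giry monad, even
    when [P A = 0]. *)
Definition restrict_probability : giry T R := mrestr P mA.

End mrestr_subprobability.

(** * The space of continuous paths in the state space *)

Section path_space.
Context (R : realType).

Definition path_generator : set_system (R -> R) :=
  \bigcup_(t in `[0%R, +oo[%classic) preimage_set_system setT (fun p : R -> R
    => p t) measurable.

Definition path_measurableType := g_sigma_algebraType path_generator.

Variables (D : set R) (x0 : R) (Dx0 : D x0).

(* On this space of good paths, unlike on all of [R -> R], debuts are measurable
   functionals.  The point of [D] only serves to make the type pointed. *)
Definition cpath & D x0 : Type :=
  {p : R -> R | {within `[0%R, +oo[, continuous p} /\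
                forall t : R, (0 <= t)%R -> D (p t)}.

HB.instance Definition _ := gen_eqMixin (cpath Dx0).
HB.instance Definition _ := gen_choiceMixin (cpath Dx0).

Let cst_path : {within `[0%R, +oo[, continuous (cst x0 : R -> R)} /\
                forall t : R, (0 <= t)%R -> D x0.
Proof. by split => // ?; exact: cvg_cst. Qed.

HB.instance Definition _ := isPointed.Build (cpath Dx0) (exist _ (cst x0)
  cst_path).

Definition cpath_fun (p : cpath Dx0) : path_measurableType := sval p.

(** This is the trace sigma-algebra: each measurable set of good paths is cut out by some [B] in
    [path_sigma], and for such [B] the Markov property is stated. *)
Definition cpathType := g_sigma_algebra_preimageType cpath_fun.

Definition canonical (t : R) (p : cpathType) : R := sval p t.

Lemma canonical_measurable (t : R) : (0 <= t)%R -> measurable_fun setT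
  (canonical t).
Proof.
move=> t0 _ B mB; rewrite setTI.
exists ((fun p => p t) @^-1` B); last by rewrite setTI.
apply: sub_sigma_algebra; exists t; first by rewrite /= in_itv/= t0.
by exists B => //; rewrite setTI.
Qed.

Lemma canonical_continuous p : {within `[0%R, +oo[, continuous (canonical ^~
  p)}.
Proof. by case: (svalP p). Qed.

Lemma canonical_state (t : R) p : (0 <= t)%R -> D (canonical t p).
Proof. by move=> t0; case: (svalP p) => _; exact. Qed.

Lemma measurable_cpathP d (T : measurableType d) (g : T -> cpathType) :
  (forall t : R, (0 <= t)%R -> measurable_fun setT (fun w =>
    canonical t (g w))) ->
  measurable_fun setT g.
Proof.
move=> mg.
have mg' : measurable_fun setT (fun w => cpath_fun (g w)).
  apply: (@measurability _ _ T path_measurableType setT _ path_generator) =>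
    // _ [_ [t t0 [B mB <-] <-]].
  by rewrite !setTI; move: t0;
    rewrite /= in_itv/= andbT => /mg/(_ measurableT B mB); rewrite setTI.
move=> _ _ [B mB <-]; rewrite !setTI.
by rewrite -[X in measurable X]setTI; exact: mg'.
Qed.

End path_space.

(** * Payoffs at random times and shifted paths *)

Section stopped_value.
Context (R : realType) d (T : measurableType d) (X : R -> T -> R).
Hypothesis mX : forall t : R, (0 <= t)%R -> measurable_fun setT (X t).
Hypothesis cX : forall w, {within `[0%R, +oo[, continuous (fun t : R => X t w)}.
Context (D : set R) (f delta : R -> R).
Hypothesis mD : measurable D.
Hypothesis XD : forall (t : R) w, (0 <= t)%R -> D (X t w).
Hypothesis f_ge0 : forall x, D x -> (0 <= f x)%R.
Hypothesis cf : {within D, continuous f}.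
Hypothesis delta_discount : discount_function delta.

Lemma discounted_payoff_ge0 w (t : R) : (0 <= t)%R ->
  (0 <= discounted_payoff X f delta w t)%R.
Proof.
move=> t0; rewrite mulr_ge0 ?f_ge0//; last exact: XD.
by have /andP[/ltW] := discount_range delta_discount t0.
Qed.

Lemma discounted_payoff_continuous w :
  continuous (fun t : R => discounted_payoff X f delta w (Num.max 0%R t)).
Proof.
have X_cont := continuous_maxr0 (@cX w).
have max_ge0 (t : R) : (0 <= Num.max 0%R t)%R by rewrite le_max lexx.
have fX := continuous_comp_in cf X_cont (fun t => XD w (max_ge0 t)).
have dc := continuous_maxr0 (discount_continuous delta_discount).
by move=> t; apply: (@continuousM _ _ _ _ _ (dc t) (fX t)).
Qed.

Lemma discounted_payoff_measurable (t : R) : (0 <= t)%R ->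
  measurable_fun setT (fun w => discounted_payoff X f delta w t).
Proof.
move=> t0; apply: measurable_funM => //.
apply: (@measurable_comp _ _ _ _ _ _ D f) => //.
- by move=> _ [w _ <-]; exact: XD.
- exact: subspace_continuous_measurable_fun.
- exact: mX.
Qed.

(* On [tau = +oo], hypothesis (b) gives the value [0] almost surely. *)
Definition stopped_value (tau : T -> \bar R) (w : T) : R :=
  if tau w is t%:E then discounted_payoff X f delta w t else 0%R.

Lemma stopped_value_ge0 tau w : 0 <= tau w -> (0 <= stopped_value tau w)%R.
Proof.
by rewrite /stopped_value; case: (tau w) => // t t0;
  exact: discounted_payoff_ge0.
Qed.

Lemma stopped_valueE tau w : 0 <= tau w -> stopped_value tau w =
  (discounted_payoff X f delta w (Num.max 0 (fine (tau w))) *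
   \1_[set w : T | (tau w < +oo)%E] w)%R.
Proof.
rewrite /stopped_value indicE; case tauE : (tau w) => [t| |]//= t0.
  by rewrite (max_idPr _)// mem_set ?mulr1//= tauE ltry.
by rewrite memNset ?mulr0//= tauE ltxx.
Qed.

Lemma measurable_stopped_value tau : (forall w, 0 <= tau w) ->
  measurable_fun setT tau -> measurable_fun setT (stopped_value tau).
Proof.
move=> tau0 mtau.
rewrite (_ : stopped_value tau = fun w =>
  (discounted_payoff X f delta w (Num.max 0 (fine (tau w))) *
   \1_[set w : T | (tau w < +oo)%E] w)%R); last by apply/funext => w;
     exact: stopped_valueE.
apply: measurable_funM.
  apply: (@measurable_random_time _ _ _ (fun (t : R) w =>
    discounted_payoff X f delta w (Num.max 0%R t)) (fine \o tau)).
  - by move=> t; apply: discounted_payoff_measurable; rewrite le_max lexx.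
  - exact: discounted_payoff_continuous.
  - exact: measurableT_comp.
apply: measurable_indic; rewrite -[X in measurable X]setTI.
exact: emeasurable_fun_infty_o.
Qed.

Lemma measurable_process_at (s : T -> R) : (forall w, (0 <= s w)%R) ->
  measurable_fun setT s -> measurable_fun setT (fun w => X (s w) w).
Proof.
move=> s0 ms.
rewrite (_ : (fun w => _) = fun w => X (Num.max 0%R (s w)) w); last first.
  by apply/funext => w; rewrite (max_idPr (s0 w)).
apply: (@measurable_random_time _ _ _ (fun (t : R) w =>
  X (Num.max 0%R t) w)) => //.
- by move=> t; apply: mX; rewrite le_max lexx.
- by move=> w; exact: (continuous_maxr0 (@cX w)).
Qed.

Variables (x0 : R) (Dx0 : D x0).

Let shift_path (s : T -> R) (s0 : forall w, (0 <= s w)%R) w :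
  {within `[0%R, +oo[, continuous (fun t : R => X (s w + t)%R w)} /\
  forall t : R, (0 <= t)%R -> D (X (s w + t)%R w).
Proof.
split; last by move=> t t0; apply: XD; rewrite addr_ge0.
apply: (@subspace_eq_continuous _ _ _ (fun t : R =>
  X (Num.max 0 (s w + t))%R w)).
  move=> t; rewrite inE /= in_itv/= andbT => t0.
  by rewrite /from_subspace (max_idPr _)// addr_ge0.
apply: continuous_subspaceT => t.
apply: (@continuous_comp R R R (fun t : R => s w + t)%R (fun t : R =>
  X (Num.max 0%R t) w)).
  by apply: cvgD; [exact: cvg_cst|exact: cvg_id].
exact: (continuous_maxr0 (@cX w)).
Qed.

Definition shift (s : T -> R) (s0 : forall w, (0 <= s w)%R) (w : T) : cpathType
  Dx0 :=
  exist _ (fun t : R => X (s w + t)%R w) (shift_path s0 w).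

Lemma measurable_shift (s : T -> R) (s0 : forall w, (0 <= s w)%R) :
  measurable_fun setT s -> measurable_fun setT (shift s0).
Proof.
move=> ms; apply: measurable_cpathP => t t0.
apply: (@measurable_process_at (fun w => s w + t)%R).
  by move=> w; rewrite addr_ge0.
exact: measurable_funD.
Qed.

End stopped_value.

(** * The strong Markov property for nonnegative path functionals *)

Section strong_markov_integral.
Context (R : realType) d (Omega : measurableType d) (D : set R)
  (P : R -> probability Omega R) (X : R -> Omega -> R).
Hypothesis mD : measurable D.
Hypothesis X_markov : continuous_strong_markov D P X.
Variables (x0 : R) (Dx0 : D x0).
Let mX := csm_measurable X_markov.
Let cX := csm_continuous X_markov.
Let XD := csm_state X_markov.

Definition whole_path : Omega -> cpathType Dx0 :=
  shift cX XD Dx0 (s := cst 0%R) (fun=> lexx _).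

Lemma measurable_whole_path : measurable_fun setT whole_path.
Proof. exact: measurable_shift. Qed.

(** Both sides integrate [Phi] against a measure on path space: on the left [m1], the image under
    the shift of [P x] restricted to [A]; on the right [m2], the mixture over [A] of the laws of the
    process restarted at [X] at time [tau]. The Markov property for events says that [m1] and [m2]
    agree on measurable sets. *)
Lemma strong_markov_integral x tau (tau0 : forall w, (0 <= fine (tau w))%R) A
    (Phi : cpathType Dx0 -> \bar R) :
  D x -> stopping_time X tau -> stopped_sigma X tau A ->
  A `<=` [set w | tau w < +oo] ->
  measurable_fun setT Phi -> (forall p, 0 <= Phi p) ->
  \int[P x]_(w in A) Phi (shift cX XD Dx0 tau0 w) =
  \int[P x]_(w in A) \int[P (X (fine (tau w)) w)]_w' Phi (whole_path w').
Proof.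
move=> Dx stau sA Atau mPhi Phi0.
have mtau := stopping_measurable mX stau.
have ms : measurable_fun setT (fine \o tau) by exact: measurableT_comp.
have mtheta := measurable_shift mX cX XD (Dx0 := Dx0) tau0 ms.
have mA := stopped_sigma_measurable mX sA.
pose law w : giry (cpathType Dx0) R :=
  giry_map measurable_whole_path (P (X (fine (tau w)) w)).
have mXtau := measurable_process_at mX cX tau0 ms.
(* Measurable dependence on the starting point is [csm_kernel]; it is composed with the position at
   time [tau]. *)
have mlaw : measurable_fun setT law.
  apply: measurable_giry_codensity => // _ [B mB <-].
  rewrite (_ : (fun w => _) = (fun y => P y [set w' | B (X ^~ w')]) \o
    (fun w => X (fine (tau w)) w)); last first.
    apply/funext => w; congr (P _ _).
    rewrite setTI; apply/seteqP; split => w' /=;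
      by rewrite /cpath_fun /= (_ : (fun t => _) = X ^~ w')//;
        apply/funext => t; rewrite add0r.
  apply: (@measurable_comp _ _ _ _ _ _ D) => //.
    by move=> _ [w _ <-]; exact: XD.
  exact: (csm_kernel X_markov).
pose m1 : giry _ R := giry_map mtheta (restrict_probability (P x) mA).
pose m2 : giry _ R := giry_bind (restrict_probability (P x) mA) mlaw.
transitivity (\int[m1]_p Phi p).
  rewrite [RHS]ge0_integral_pushforward//.
  rewrite preimage_setT; apply/esym.
  exact: (ge0_integral_mrestr (P x) mA (measurableT_comp mPhi mtheta) (fun=>
    Phi0 _)).
have law_ge0 U w : 0 <= law w U by exact: measure_ge0.
transitivity (\int[m2]_p Phi p).
  apply: eq_measure_integral => U mU _.
  transitivity (\int[P x]_(w in A) law w U); last first.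
    rewrite -(ge0_integral_mrestr (P x) mA (measurableT_comp
      (measurable_giry_ev mU) mlaw) (law_ge0 U)).
    by rewrite [RHS]giry_int_map//; exact: measurable_giry_ev.
  case: mU => B mB <-; rewrite setTI.
  rewrite /m1 /giry_map /= /pushforward /mrestr /=.
  have := csm_strong_markov X_markov Dx stau sA mB.
  rewrite (setIidl Atau) => E.
  transitivity (P x (A `&` [set w | tau w < +oo /\ B (fun t =>
    X (fine (tau w) + t)%R w)])).
    congr (P x _); apply/seteqP; split => w /= [].
      by move=> ? Aw; split => //; split => //; exact: Atau.
    by move=> Aw [].
  rewrite E; apply: eq_integral => w _; congr (P _ _); apply/seteqP.
  split => w' /=; rewrite /cpath_fun /= (_ : (fun t =>
    X (0 + t) w') = X ^~ w')//;
    by apply/funext => t; rewrite add0r.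
rewrite [LHS]giry_int_bind// /giry_int.
rewrite (ge0_integral_mrestr (P x) mA (measurableT_comp (measurable_giry_int
  mPhi Phi0) mlaw)).
  apply: eq_integral => w _; rewrite [LHS]ge0_integral_pushforward//.
  exact: measurable_whole_path.
by move=> w; apply: integral_ge0 => p _; exact: Phi0.
Qed.

End strong_markov_integral.

(** * Comparison of integrals without measurability *)

Section nonmeasurable.
Import HBNNSimple.

(* Needed because [stopped_payoff] is not shown to be measurable: a simple
   function below [f] stays below [g] once it is set to [0] on a null set. *)
Lemma ae_ge0_le_integral_nonmeasurable (R : realType) d (T : measurableType d)
    (mu : {measure set T -> \bar R}) (f g : T -> \bar R) :
  (forall w, 0 <= f w) -> (forall w, 0 <= g w) ->
  {ae mu, forall w, f w <= g w} -> \int[mu]_w f w <= \int[mu]_w g w.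
Proof.
move=> f0 g0 [N [mN N0 fgN]].
rewrite !ge0_integralE//; apply: ge_ereal_sup => _ [h /= hf <-].
have mNc : measurable (~` N) by exact: measurableC.
pose h' := proj_nnsfun h mNc.
have h'E w : h' w = (h w * \1_(~` N) w)%R by [].
have -> : sintegral mu h = sintegral mu h'.
  rewrite -!integralT_nnsfun; apply: ge0_ae_eq_integral => //.
  - exact/measurable_EFinP.
  - exact/measurable_EFinP.
  - by move=> w _; rewrite lee_fin.
  - by move=> w _; rewrite lee_fin.
  exists N; split => // w /= hh'; apply: contrapT => Nw; apply: hh' => _.
  by rewrite /= /mindic indicE mem_set// mulr1.
apply: ereal_sup_ubound; exists h' => // w;
  rewrite patchE (@mem_set _ setT w I) h'E indicE.
have hfw : (h w)%:E <= f w by have := hf w;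
  rewrite patchE (@mem_set _ setT w I).
have [Nw|Nw] := pselect (N w).
  by rewrite memNset ?mulr0//; exact.
rewrite mem_set// mulr1; apply: le_trans hfw _.
by apply: contrapT => nfg; apply: Nw; exact: fgN.
Qed.

Lemma ae_eq_integral_nonmeasurable (R : realType) d (T : measurableType d)
    (mu : {measure set T -> \bar R}) (f g : T -> \bar R) :
  (forall w, 0 <= f w) -> (forall w, 0 <= g w) ->
  {ae mu, forall w, f w = g w} -> \int[mu]_w f w = \int[mu]_w g w.
Proof.
move=> f0 g0 fg; apply/eqP; rewrite eq_le; apply/andP; split;
  by apply: ae_ge0_le_integral_nonmeasurable => //; apply: filterS fg => w ->.
Qed.

End nonmeasurable.

(** * One more hit does not decrease the expected payoff *)

Section one_more_hit.
Context (R : realType) d (Omega : measurableType d) (D : set R)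
  (P : R -> probability Omega R) (X : R -> Omega -> R) (f delta : R -> R).
Hypothesis mD : measurable D.
Hypothesis X_markov : continuous_strong_markov D P X.
Hypothesis f_ge0 : forall x, D x -> (0 <= f x)%R.
Hypothesis cf : {within D, continuous f}.
Hypothesis delta_discount : discount_function delta.
Variables (C : set R) (cC : closed C) (x : R) (Dx : D x).
Let mX := csm_measurable X_markov.
Let cX := csm_continuous X_markov.
Let XD := csm_state X_markov.

(** The payoff at the debut of [C], read off the path alone, as [strong_markov_integral]
    requires. *)
Let Phi (p : cpathType Dx) : R :=
  stopped_value (@canonical R D x Dx) f delta (debut (@canonical R D x Dx) (cst
    0) C) p.

Let Phi_ge0 p : (0 <= Phi p)%R.
Proof.
apply: (stopped_value_ge0 (@canonical_state R D x Dx)) => //; exact: debut_ge.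
Qed.

Let measurable_Phi : measurable_fun setT Phi.
Proof.
apply: (measurable_stopped_value (@canonical_measurable R D x Dx)
  (@canonical_continuous R D x Dx) mD (@canonical_state R D x Dx) cf
    delta_discount).
  by move=> p; exact: debut_ge.
apply: (stopping_measurable (@canonical_measurable R D x Dx)).
apply: (debut_stopping (@canonical_continuous R D x Dx)) => //.
exact: stopping_time0.
Qed.

Let Phi_whole_path w : Phi (whole_path X_markov Dx w) =
  stopped_value X f delta (debut X (cst 0) C) w.
Proof.
have E t : canonical t (whole_path X_markov Dx w) = X t w.
  by rewrite /canonical /= add0r.
rewrite /Phi /stopped_value /debut.
have -> : [set t : R | cst 0%R (whole_path X_markov Dx w) <= t%:E /\
   C (canonical t (whole_path X_markov Dx w))] =
   [set t : R | cst 0%R w <= t%:E /\ C (X t w)].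
  by apply/seteqP; split => t /=; rewrite add0r.
by case: ereal_inf => // t; rewrite /discounted_payoff E.
Qed.

Let discount_mul (s t : R) : (0 <= s)%R -> (0 <= t)%R -> (delta s * delta t <=
  delta (s + t))%R.
Proof.
have d0 := discount0 delta_discount.
rewrite !le_eqVlt => /predU1P[<-|s0]; first by rewrite d0 mul1r add0r eqxx.
move=> /predU1P[<-|t0]; first by rewrite d0 mulr1 addr0 eqxx.
by rewrite -le_eqVlt; exact: discount_log_subadditive.
Qed.

(** If the shifted path meets [C], the debut after [tau] is [tau] plus the debut of the shifted
    path, so the two sides differ only in [delta s * delta t] against [delta (s + t)]. If it does
    not, the left side is [0]. *)
Let Phi_shift tau (tau0 : forall w, (0 <= fine (tau w))%R) w : tau w \is a
  fin_num ->
  (delta (fine (tau w)) * Phi (shift cX XD Dx tau0 w) <=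
   stopped_value X f delta (debut X tau C) w)%R.
Proof.
move=> tfin.
set p := shift cX XD Dx tau0 w; set t := fine (tau w).
have tauE : tau w = t%:E by rewrite fineK.
have t0 : (0 <= t)%R by exact: tau0.
have tau0' : 0 <= tau w by rewrite tauE lee_fin.
have dX := debut_ge X tau C w.
rewrite /Phi {1}/stopped_value.
have dge := debut_ge (@canonical R D x Dx) (cst 0) C p.
case dE : (debut _ _ _ p) => [u| |]; last 2 first.
- rewrite mulr0; apply: (stopped_value_ge0 XD) => //; exact: le_trans dX.
- rewrite mulr0; apply: (stopped_value_ge0 XD) => //; exact: le_trans dX.
have u0 : (0 <= u)%R by rewrite dE lee_fin in dge.
have Cu : C (X (t + u)%R w).
  exact: (debut_attained (@canonical_continuous R D x Dx) cC _ dE).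
have le1 : debut X tau C w <= (t + u)%:E.
  by apply: debut_lb => //; rewrite tauE lee_fin lerDl.
rewrite /stopped_value; case vE : (debut X tau C w) => [v| |]//; last 2 first.
- by rewrite vE in le1.
- by rewrite vE in dX; have := le_trans tau0' dX.
have tv : (t <= v)%R by rewrite vE tauE lee_fin in dX.
have Cv : C (X v w) by exact: (debut_attained cX cC tau0' vE).
have le2 : (u <= v - t)%R.
  rewrite -lee_fin -dE; apply: debut_lb; first by rewrite lee_fin subr_ge0.
  by rewrite /canonical /= -/t addrC subrK.
have -> : v = (t + u)%R.
  apply/eqP; rewrite eq_le; rewrite vE lee_fin in le1; rewrite le1 /=; lra.
rewrite /discounted_payoff /canonical /= -/t mulrA ler_wpM2r ?discount_mul//.
by rewrite f_ge0//; apply: XD; rewrite addr_ge0.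
Qed.

Lemma le_integral_stopped_value_debut tau : stopping_time X tau ->
  (forall y, D y -> (f y)%:E <=
    \int[P y]_w (stopped_value X f delta (debut X (cst 0) C) w)%:E) ->
  \int[P x]_w (stopped_value X f delta tau w)%:E <=
  \int[P x]_w (stopped_value X f delta (debut X tau C) w)%:E.
Proof.
move=> stau Hf.
have stau' := debut_stopping cX cC stau.
have mtau := stopping_measurable mX stau.
have mtau' := stopping_measurable mX stau'.
have tau0 := stau.1.
have ftau0 w : (0 <= fine (tau w))%R by rewrite fine_ge0.
have mftau : measurable_fun setT (fine \o tau) by exact: measurableT_comp.
(* [delta tau] is approximated from below by its values at [tau] rounded up to a
   multiple of [1 / n.+1], so that the strong Markov property is only needed on
   the sets [{(i - 1) / n.+1 < tau <= i / n.+1}]; Fatou gives the limit. *)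
pose V w := (f (X (fine (tau w)) w) * \1_[set w : Omega | (tau w < +oo)%E] w)%R.
have mtauy : measurable [set w : Omega | (tau w < +oo)%E].
  by rewrite -[X in measurable X]setTI; exact: emeasurable_fun_infty_o.
have mfX : measurable_fun setT (fun w => f (X (fine (tau w)) w)).
  apply: (@measurable_comp _ _ _ _ _ _ D f) => //.
  - by move=> _ [w _ <-]; exact: XD.
  - exact: subspace_continuous_measurable_fun.
  - exact: (measurable_process_at mX cX ftau0).
have fX0 w : (0 <= f (X (fine (tau w)) w))%R by apply: f_ge0; exact: XD.
have mV : measurable_fun setT V by apply: measurable_funM => //;
  exact: measurable_indic.
have V0 w : (0 <= V w)%R by rewrite mulr_ge0// indicE.
have WV w : stopped_value X f delta tau w = (delta (fine (tau w)) * V w)%R.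
  rewrite (stopped_valueE _ _ _ (tau0 w)) /discounted_payoff /V mulrA.
  by rewrite (max_idPr (ftau0 w)).
(* This is the ceiling of [tau * n.+1] divided by [n.+1], written with a floor so that
   [measurable_floor_index] and [cvg_floor_divn] apply. *)
pose c n w : R := (- ((Num.floor (- fine (tau w) * n.+1%:R)%R)%:~R /
  n.+1%:R))%R.
have cvgc w : c ^~ w @ \oo --> fine (tau w).
  rewrite -[X in _ --> X]opprK; apply: cvgN; exact: cvg_floor_divn.
have cdelta := continuous_maxr0 (discount_continuous delta_discount).
pose G n w := (delta (Num.max 0 (c n w)) * V w)%R.
have mG n : measurable_fun setT (G n).
  apply: measurable_funM => //.
  apply: (measurable_floor_index (F := fun z _ =>
    delta (Num.max 0 (- (z%:~R / n.+1%:R)))%R)) => //.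
  by apply: measurable_funM => //; exact: measurableT_comp.
have max_ge0 (t : R) : (0 <= Num.max 0%R t)%R by rewrite le_max lexx.
have delta0 (t : R) : (0 <= t)%R -> (0 <= delta t)%R.
  by move=> /(discount_range delta_discount)/andP[/ltW].
have G0 n w : (0 <= G n w)%R by rewrite mulr_ge0 ?delta0.
have cvgG w : (G n w)%:E @[n --> \oo] --> (stopped_value X f delta tau w)%:E.
  apply/cvg_EFin; first exact: nearW.
  rewrite WV; apply: cvgM; last exact: cvg_cst.
  rewrite -{1}(max_idPr (ftau0 w)).
  exact: (cvg_comp _ (fun t => delta (Num.max 0 t)%R) (cvgc w) (cdelta _)).
rewrite [leLHS](_ : _ = \int[P x]_w limn_einf (fun n => (G n w)%:E));
  last first.
  by apply: eq_integral => w _; rewrite (cvg_limn_einf_sup (cvgG w)).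
apply: le_trans (fatou _ _ _ _) _ => //.
- by move=> n; exact/measurable_EFinP.
- by move=> n w _; rewrite lee_fin.
suff GW n : \int[P x]_w (G n w)%:E <=
    \int[P x]_w (stopped_value X f delta (debut X tau C) w)%:E.
  apply: le_trans (limn_einf_sup _) _; rewrite /limn_esup.
  set u := (fun n : nat => _).
  apply: (@le_trans _ _ (ereal_sup (u @` setT))).
    by apply: ereal_inf_lbound; exists setT => //; exact: filterT.
  by apply: ge_ereal_sup => _ [n _ <-]; exact: GW.
(* The index [0] is included: its slice is the event [tau = 0], so that the slices cover all of
   [tau < +oo]. *)
pose A (i : nat) := [set w : Omega | ((i%:R - 1) / n.+1%:R)%:E < tau w <= (i%:R
  / n.+1%:R)%:E].
have in0 (i : nat) : (0 <= i%:R / n.+1%:R :> R)%R by rewrite divr_ge0.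
have sA i : stopped_sigma X tau (A i) by exact: stopped_sigma_itv.
have mA i : measurable (A i) := stopped_sigma_measurable mX (sA i).
have Afin i w : A i w -> tau w \is a fin_num.
  by move=> /andP[_ tw]; rewrite ge0_fin_numE// (le_lt_trans tw) ?ltry.
have Abnd i w : A i w -> (i%:R - 1 < fine (tau w) * n.+1%:R <= i%:R)%R.
  move=> Aw; have := Aw;
    rewrite /A /= -(fineK (Afin _ _ Aw)) lee_fin lte_fin /=.
  by rewrite ltr_pdivrMr// ler_pdivlMr.
have Ac i w : A i w -> Num.floor (- fine (tau w) * n.+1%:R)%R = (- i%:Z)%R.
  move=> /Abnd/andP[h1 h2]; apply: floor_def.
  by rewrite intrD !intrN mulNr lerN2 h2 /= ltrNl opprD opprK.
have tA : trivIset setT A.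
  apply/trivIsetP => i j _ _ ij; apply/seteqP; split => // w [/Ac Ai /Ac].
  by rewrite Ai => /oppr_inj [] /eqP; rewrite (negbTE ij).
have AE : \bigcup_i A i = [set w | (tau w < +oo)%E].
  apply/seteqP; split => w; first by move=> [i _ /Afin]; rewrite ge0_fin_numE.
  rewrite /= -ge0_fin_numE// => tfin.
  have /andP[] := ceil_itv (fine (tau w) * n.+1%:R)%R.
  set z := Num.ceil _ => z1 z2.
  have z0 : (0 <= z)%R by rewrite -(ler_int R) (le_trans _ z2)// mulr_ge0.
  exists `|z|%N => //.
  rewrite /A /= natr_absz (ger0_norm z0) -(fineK tfin) lee_fin lte_fin.
  by rewrite ltr_pdivrMr// ler_pdivlMr// z2 andbT; rewrite intrB in z1.
have mW' := measurable_stopped_value mX cX mD XD cf delta_discount stau'.1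
  mtau'.
apply: (@le_trans _ _ (\int[P x]_(w in \bigcup_i A i) (G n w)%:E)).
  rewrite [leRHS]integral_mkcond le_eqVlt; apply/orP; left; apply/eqP.
  apply: eq_integral => w _; rewrite patchE AE; case: ifPn => // /negP wtau.
  by rewrite /G /V indicE memNset ?mulr0// => tw; apply: wtau; rewrite inE.
apply: (@le_trans _ _ (\int[P x]_(w in \bigcup_i A i)
    (stopped_value X f delta (debut X tau C) w)%:E)); last first.
  apply: ge0_subset_integral => //; first exact: bigcup_measurable.
    exact/measurable_EFinP.
  by move=> w _; rewrite lee_fin (stopped_value_ge0 XD)// stau'.1.
have mGA : measurable_fun (\bigcup_i A i) (fun w => (G n w)%:E).
  by apply: (@measurable_funS _ _ _ _ setT) => //; exact/measurable_EFinP.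
have mW'A : measurable_fun (\bigcup_i A i)
    (fun w => (stopped_value X f delta (debut X tau C) w)%:E).
  by apply: (@measurable_funS _ _ _ _ setT) => //; exact/measurable_EFinP.
have W'0 w : 0 <= (stopped_value X f delta (debut X tau C) w)%:E.
  by rewrite lee_fin (stopped_value_ge0 XD)// stau'.1.
rewrite !ge0_integral_bigcup//; last by move=> w _; rewrite lee_fin.
apply: lee_nneseries => [i _ _|i _].
  by apply: integral_ge0 => w _; rewrite lee_fin.
have dn0 : (0 <= delta (i%:R / n.+1%:R))%R by exact: delta0.
have Atau : A i `<=` [set w | (tau w < +oo)%E].
  by move=> w /Afin; rewrite ge0_fin_numE.
have mPhiS : measurable_fun (A i) (fun w => (Phi (shift cX XD Dx ftau0 w))%:E).
  apply: (@measurable_funS _ _ _ _ setT) => //; apply/measurable_EFinP.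
  exact: (measurableT_comp measurable_Phi (measurable_shift mX cX XD (Dx0 :=
    Dx) ftau0 mftau)).
have PhiS0 w : 0 <= (Phi (shift cX XD Dx ftau0 w))%:E by rewrite lee_fin.
(* On [A i] the rounded discount is a constant, at most [delta] at [tau], and can be taken out of
   the integral. [Phi_shift] bounds the intermediate term from above; the Markov property and [Hf]
   bound it from below. *)
apply: (@le_trans _ _ (\int[P x]_(w in A i) ((delta (i%:R / n.+1%:R))%:E *
    (Phi (shift cX XD Dx ftau0 w))%:E))); last first.
  apply: ge0_le_integral => //.
  - by move=> w _; rewrite mule_ge0 ?lee_fin.
  - exact: measurable_funeM.
  - by apply: (@measurable_funS _ _ _ _ setT) => //; exact/measurable_EFinP.
  move=> w Aw; apply: le_trans (_ : (delta (fine (tau w)) * Phi (shift cX XD Dx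
    ftau0 w))%:E <= _); last first.
    by rewrite lee_fin; apply: Phi_shift; exact: Afin Aw.
  rewrite -EFinM lee_fin ler_wpM2r//;
    apply: (discount_nonincreasing delta_discount) => //.
  by move: Aw => /Abnd/andP[_]; rewrite ler_pdivlMr.
rewrite [leLHS](_ : _ = \int[P x]_(w in A i) ((delta (i%:R / n.+1%:R))%:E *
    (f (X (fine (tau w)) w))%:E)); last first.
  apply: eq_integral => w; rewrite inE => Aw.
  rewrite /G /V /c (Ac _ _ Aw) indicE mem_set ?mulr1; last exact: Atau Aw.
  by rewrite mulrNz mulNr opprK (max_idPr (in0 i)) EFinM.
rewrite !ge0_integralZl//; last 2 first.
- by apply: (@measurable_funS _ _ _ _ setT) => //; exact/measurable_EFinP.
- by move=> w _; rewrite lee_fin.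
apply: lee_wpmul2l; first by rewrite lee_fin.
rewrite (strong_markov_integral mD X_markov ftau0 Dx stau (sA i) Atau (Phi :=
  EFin \o Phi))//.
- rewrite integral_mkcond [leRHS]integral_mkcond.
  have PhiP0 w : 0 <= \int[P (X (fine (tau w)) w)]_w' (EFin \o Phi) (whole_path
    X_markov Dx w').
    by apply: integral_ge0 => w' _; rewrite lee_fin.
  (* The inner integral has not been shown measurable in [w]. *)
  apply: ae_ge0_le_integral_nonmeasurable.
  + by move=> w; apply: erestrict_ge0 => w' _; rewrite lee_fin.
  + by move=> w; apply: erestrict_ge0 => w' _; exact: PhiP0.
  apply: aeW => w; apply: lee_restrict => {}w _.
  apply: le_trans (Hf _ _) _; first exact: XD.
  rewrite le_eqVlt; apply/orP; left; apply/eqP.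
  by apply: eq_integral => w' _ /=; rewrite Phi_whole_path.
- exact/measurable_EFinP.
Qed.

End one_more_hit.

(** * From payoffs at hitting times to values at debuts *)

Lemma limf_esup_pinfty_ge0 (R : realType) (g : R -> R) :
  (forall t, (0 <= t)%R -> (0 <= g t)%R) ->
  0 <= limf_esup (fun t => (g t)%:E) +oo%R.
Proof.
move=> g0; apply: le_ereal_inf_tmp => y [V [M [_ MV]] <-].
pose t := (Num.max 0 M + 1)%R.
have t0 : (0 <= t)%R by rewrite addr_ge0// le_max lexx.
apply: (@le_trans _ _ (g t)%:E); first by rewrite lee_fin g0.
apply: ereal_sup_ubound; exists t => //; apply: MV.
by rewrite /t ltr_pwDr// le_max lexx orbT.
Qed.

Lemma cvg_limf_esup0 (R : realType) (g : R -> R) :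
  (forall t, (0 <= t)%R -> (0 <= g t)%R) -> g t @[t --> +oo%R] --> 0%R ->
  limf_esup (fun t => (g t)%:E) +oo%R = 0.
Proof.
move=> g0 gcvg; apply/eqP; rewrite eq_le limf_esup_pinfty_ge0// andbT.
apply/lee_addgt0Pr => e e0; rewrite add0e.
apply: (@le_trans _ _ (ereal_sup ((fun t =>
  (g t)%:E) @` [set t | (g t <= e)%R]))).
  by apply: ereal_inf_lbound; exists [set t | (g t <= e)%R] => //=;
    exact: cvgr_le gcvg _ e0.
by apply: ge_ereal_sup => _ [t /= te <-]; rewrite lee_fin.
Qed.

(** Lets an open condition at some real time be tested at rational times, so that events about
    suprema become countable unions. *)
Lemma continuous_ratr_preimage (R : realType) (g : R -> R) (U : set R) (s : R) :
  continuous g -> open U -> U (g s) -> exists q : rat, U (g (ratr q)).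
Proof.
move=> cg oU Ugs.
have oV : open (g @^-1` U) by exact: (continuousP g).1.
have [y [/= Uy [q _ qE]]] := @dense_rat R (g @^-1` U) (ex_intro _ s Ugs) oV.
by exists q; rewrite qE.
Qed.

Section continuous_sup.
Context (R : realType) d (T : measurableType d) (Y : R -> T -> R).
Hypothesis mY : forall t : R, (0 <= t)%R -> measurable_fun setT (Y t).
Hypothesis cY : forall w, continuous (fun t : R => Y (Num.max 0%R t) w).

Lemma measurable_exists_gt (x t : R) : (0 <= t)%R ->
  measurable [set w | exists2 s : R, s \in `[0%R, t] & (x < Y s w)%R].
Proof.
move=> t0; pose clip (u : R) := Num.min t (Num.max 0%R u).
have clip0 u : (0 <= clip u)%R by rewrite le_min t0 le_max lexx.
have cclip : continuous clip.
  move=> u; apply: (@continuous_min _ _ (cst t) (fun u : R => Num.max 0%R u));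
    first exact: cvg_cst.
  by apply: (@continuous_max _ _ (cst 0%R) id); [exact: cvg_cst|exact: cvg_id].
rewrite (_ : mkset _ = \bigcup_(q : rat) Y (clip (ratr q)) @^-1` `]x,
  +oo[%classic).
  apply: countable_bigcupT_measurable => // q.
  by rewrite -[X in measurable X]setTI; exact: mY.
apply/seteqP; split => w /=.
  move=> [s]; rewrite in_itv/= => /andP[s0 st] xs.
  have cYc : continuous (fun u => Y (Num.max 0 (clip u))%R w).
    by move=> u; apply: (@continuous_comp _ _ _ clip (fun t : R =>
      Y (Num.max 0%R t) w)); [exact: cclip|exact: cY].
  have [||q /=] := continuous_ratr_preimage (U := `]x, +oo[%classic) (s := s)
    cYc; first exact: rray_open.
    by rewrite /= in_itv/= /clip !(max_idPr _)// (min_idPr _) ?xs// ?(max_idPr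
      _).
  by rewrite (max_idPr (clip0 _)) => qx; exists q.
move=> [q _ /=]; rewrite in_itv/= andbT => xq.
by exists (clip (ratr q)) => //; rewrite in_itv/= clip0 ge_min lexx.
Qed.

(** The real [sup] dominates its set only if the set is bounded; the extreme value theorem supplies
    the bound. *)
Lemma lt_sup_imageP (x t : R) w : (0 <= t)%R ->
  (x < sup [set Y s w | s in `[0%R, t]])%R <-> exists2 s : R, s \in `[0%R, t] &
    (x < Y s w)%R.
Proof.
move=> t0.
have I0 : `[0%R, t]%classic 0%R by rewrite /= in_itv/= lexx.
split.
  move=> /sup_gt[]; first by exists (Y 0%R w), 0%R.
  by move=> _ [s st <-] xs; exists s.
move=> [s st xs]; apply: lt_le_trans xs _; apply: ub_le_sup; last by exists s.
have [c _ cmax] := EVT_max t0 (continuous_subspaceT (@cY w)).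
exists (Y (Num.max 0 c)%R w) => _ [u /= uI <-].
have := cmax _ uI; rewrite (max_idPr _)//.
by move: uI; rewrite in_itv/= => /andP[].
Qed.

Lemma measurable_ereal_sup : measurable_fun setT
  (fun w => ereal_sup [set (Y t w)%:E | t in `[0%R, +oo[]).
Proof.
apply: (measurability _ (ErealGenOInfty.measurableE R)) => _ [_ [r ->] <-].
rewrite setTI (_ : _ @^-1` _ = \bigcup_(q : rat) Y (Num.max 0%R (ratr q)) @^-1`
  `]r, +oo[%classic).
  apply: countable_bigcupT_measurable => // q.
  by rewrite -[X in measurable X]setTI; apply: mY => //; rewrite le_max lexx.
apply/seteqP; split => w /=; rewrite in_itv/= andbT.
  move=> /ereal_sup_gt[y [t /= ]]; rewrite in_itv/= andbT => t0 <-;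
    rewrite lte_fin => rt.
  have [||q /=] := continuous_ratr_preimage (U := `]r, +oo[%classic) (s := t)
    (@cY w); first exact: rray_open.
    by rewrite /= in_itv/= (max_idPr t0) rt.
  by move=> qr; exists q.
move=> [q _ /=]; rewrite in_itv/= andbT => rq.
apply/ereal_sup_gtP; exists (Y (Num.max 0%R (ratr q)) w)%:E;
  last by rewrite lte_fin.
by exists (Num.max 0%R (ratr q)) => //=; rewrite in_itv/= le_max lexx.
Qed.

End continuous_sup.

Lemma ae_probability1 (R : realType) d (T : measurableType d)
    (P : probability T R) (A : set T) :
  measurable A -> P A = 1 -> {ae P, forall w, A w}.
Proof.
move=> mA PA; exists (~` A); split => //; first exact: measurableC.
by rewrite probability_setC// PA subee.
Qed.

Section stopped_payoff.
Context (R : realType) d (Omega : measurableType d) (D : set R)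
  (P : R -> probability Omega R) (X : R -> Omega -> R) (f delta : R -> R).
Hypothesis X_markov : continuous_strong_markov D P X.
Hypothesis f_ge0 : forall x, D x -> (0 <= f x)%R.
Hypothesis cf : {within D, continuous f}.
Hypothesis delta_discount : discount_function delta.
Let mX := csm_measurable X_markov.
Let cX := csm_continuous X_markov.
Let XD := csm_state X_markov.

Lemma hitting_time_ge0 A w : 0 <= hitting_time X A w.
Proof. by apply: le_ereal_inf_tmp => y [t [/ltW t0 _] <-]; rewrite lee_fin. Qed.

Lemma stopped_payoff_ge0 A w : 0 <= stopped_payoff X f delta A w.
Proof.
have Z0 := discounted_payoff_ge0 XD f_ge0 delta_discount w.
rewrite /stopped_payoff; have := hitting_time_ge0 A w.
have limf0 : 0 <= limf_esup (fun t : R =>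
  (discounted_payoff X f delta w t)%:E) +oo%R.
  exact: limf_esup_pinfty_ge0.
by case: hitting_time => // t; rewrite !lee_fin; exact: Z0.
Qed.

(** For a start outside [A], the conditions [t > 0] and [t >= 0] select the same times; if there are
    none, the limsup is [0]. The path stays in [D], hence cannot distinguish [A] from a [C] with the
    same trace on [D]; in use, [C] is closed in the whole line. *)
Lemma stopped_payoffE A C w : (forall x, D x -> A x <-> C x) -> ~ A (X 0%R w) ->
  discounted_payoff X f delta w t @[t --> +oo%R] --> 0%R ->
  stopped_payoff X f delta A w = (stopped_value X f delta (debut X (cst 0) C)
    w)%:E.
Proof.
move=> AC A0 wcvg.
have hE : hitting_time X A w = debut X (cst 0) C w.
  congr (ereal_inf (image _ _)); apply/seteqP; split => t /=.
    by move=> [t0 At]; rewrite lee_fin ltW//; split => //; apply/AC => //;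
      apply: XD; exact: ltW.
  rewrite lee_fin le_eqVlt => -[/predU1P[<-|t0] Ct]; last by split => //;
    apply/AC => //; apply: XD; exact: ltW.
  by exfalso; apply: A0; apply/AC => //; exact: XD.
rewrite /stopped_payoff /stopped_value -hE; have := hitting_time_ge0 A w.
have Z0 := discounted_payoff_ge0 XD f_ge0 delta_discount w.
by case: hitting_time => // _; exact: cvg_limf_esup0.
Qed.

(** A path that is above and below [x] at arbitrarily small times crosses [x] in between, so it
    returns to [x], a point of [A], at arbitrarily small positive times. *)
Lemma stopped_payoff_return A x w : A x -> X 0%R w = x ->
  (forall n : nat, exists2 s : R, s \in `[0%R, n.+1%:R^-1%R] & (x < X s w)%R) ->
  (forall n : nat, exists2 s : R, s \in `[0%R, n.+1%:R^-1%R] & (X s w < x)%R) ->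
  stopped_payoff X f delta A w = (f x)%:E.
Proof.
move=> Ax X0 up down.
have hit0 : hitting_time X A w = 0.
  apply/eqP; rewrite eq_le hitting_time_ge0 andbT; apply/lee_addgt0Pr => e e0.
  rewrite add0e.
  have [n ne] : exists n : nat, (n.+1%:R^-1 < e)%R.
    by have [k _ /(_ k (leqnn k))] := near_infty_natSinv_lt (PosNum e0);
      exists k.
  have [s] := up n; rewrite in_itv/= => /andP[s0 sn] xs.
  have [u] := down n; rewrite in_itv/= => /andP[u0 un] ux.
  (* The two times are positive because the path starts at [x] and is off [x] there; this keeps the
     crossing time away from [0]. *)
  have pos v : (0 <= v)%R -> X v w != x -> (0 < v)%R.
    by rewrite le_eqVlt => /predU1P[<-|//]; rewrite X0 eqxx.
  have s0' : (0 < s)%R by apply: pos => //; rewrite gt_eqF.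
  have u0' : (0 < u)%R by apply: pos => //; rewrite lt_eqF.
  have [v [v0 vn Xv]] : exists v : R, [/\ (0 < v)%R, (v <= n.+1%:R^-1)%R & X v
    w = x].
    have ivt a b : (0 < a)%R -> (a <= b)%R -> (b <= n.+1%:R^-1)%R ->
        (Num.min (X a w) (X b w) <= x <= Num.max (X a w) (X b w))%R ->
        exists v : R, [/\ (0 < v)%R, (v <= n.+1%:R^-1)%R & X v w = x].
      move=> a0 ab bn xab; have b0 := lt_le_trans a0 ab.
      have := IVT ab (continuous_subspaceT (continuous_maxr0 (@cX w))) (v := x).
      rewrite (max_idPr (ltW a0)) (max_idPr (ltW b0)) => /(_ xab)[v].
      rewrite in_itv/= => /andP[av vb]; have v0 := lt_le_trans a0 av.
      by rewrite (max_idPr (ltW v0)) => Xv; exists v; split => //;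
        exact: le_trans bn.
    have [su|us] := leP s u.
      apply: (ivt s u) => //.
      by rewrite ge_min le_max (ltW ux) (ltW xs) orbT.
    apply: (ivt u s) => //; first exact: ltW.
    by rewrite ge_min le_max (ltW ux) (ltW xs) orbT.
  apply: (@le_trans _ _ v%:E); last by rewrite lee_fin (le_trans vn)// ltW.
  by apply: ereal_inf_lbound; exists v => //; split => //; rewrite Xv.
by rewrite /stopped_payoff hit0 /= /discounted_payoff X0 (discount0
  delta_discount) mul1r.
Qed.

Lemma ae_start x : D x -> {ae P x, forall w, X 0%R w = x}.
Proof.
move=> Dx; apply: ae_probability1; last exact: csm_start X_markov _ Dx.
rewrite (_ : (fun w => _) = setT `&` X 0%R @^-1` [set x]);
  last by rewrite setTI.
exact: mX.
Qed.

Lemma J_notin x A C : D x -> (forall y, D y -> A y <-> C y) -> ~ A x ->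
  {ae P x, forall w, discounted_payoff X f delta w t @[t --> +oo%R] --> 0%R} ->
  J P X f delta x A =
  \int[P x]_w (stopped_value X f delta (debut X (cst 0) C) w)%:E.
Proof.
move=> Dx AC Ax bx; apply: ae_eq_integral_nonmeasurable.
- exact: stopped_payoff_ge0.
- by move=> w; rewrite lee_fin (stopped_value_ge0 XD)//; exact: debut_ge.
apply: filterS2 bx (ae_start Dx) => w wcvg X0; apply: stopped_payoffE => //.
by rewrite X0.
Qed.

Lemma integral_stopped_value_start x tau : D x -> (forall w, 0 <= tau w) ->
  (forall w, X 0%R w = x -> tau w = 0) ->
  \int[P x]_w (stopped_value X f delta tau w)%:E = (f x)%:E.
Proof.
move=> Dx tau0 taux.
rewrite (_ : (f x)%:E = \int[P x]_w (f x)%:E); last first.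
  by rewrite integral_cst// [X in _ * X]probability_setT mule1.
apply: ae_eq_integral_nonmeasurable.
- by move=> w; rewrite lee_fin (stopped_value_ge0 XD).
- by move=> w; rewrite lee_fin f_ge0.
apply: filterS (ae_start Dx) => w X0.
by rewrite /stopped_value taux//= /discounted_payoff X0 (discount0
  delta_discount) mul1r.
Qed.

Lemma J_in x A : D x -> A x ->
  (forall t : R, (0 < t)%R ->
    P x [set w | (x < sup [set X s w | s in `[0%R, t]])%R] = 1 /\
    P x [set w | (inf [set X s w | s in `[0%R, t]] < x)%R] = 1) ->
  J P X f delta x A = (f x)%:E.
Proof.
move=> Dx Ax ax.
rewrite (_ : (f x)%:E = \int[P x]_w (f x)%:E); last first.
  by rewrite integral_cst// [X in _ * X]probability_setT mule1.
have up n : {ae P x, forall w, exists2 s : R, s \in `[0%R, n.+1%:R^-1%R] & (x <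
  X s w)%R}.
  have n0 : (0 < n.+1%:R^-1 :> R)%R by rewrite invr_gt0.
  apply: ae_probability1;
    first exact: (measurable_exists_gt mX (fun w =>
    continuous_maxr0 (@cX w)) x (ltW n0)).
  rewrite -(ax _ n0).1; congr (P x _); apply/seteqP; split => w /=.
    exact: (lt_sup_imageP (fun w => continuous_maxr0 (@cX w)) x w (ltW n0)).2.
  exact: (lt_sup_imageP (fun w => continuous_maxr0 (@cX w)) x w (ltW n0)).1.
(* [inf] is by definition the opposite of the [sup] of the opposites, so the lemmas on suprema,
   applied to [- X], treat the minimum. *)
pose Y (t : R) w := (- X t w)%R.
have mY (t : R) : (0 <= t)%R -> measurable_fun setT (Y t).
  by move=> t0; apply: measurableT_comp => //; exact: mX.
have cY w : continuous (fun t : R => Y (Num.max 0%R t) w).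
  by move=> t; apply: cvgN; exact: (continuous_maxr0 (@cX w)).
have down n : {ae P x, forall w, exists2 s : R, s \in `[0%R, n.+1%:R^-1%R] & (X
  s w < x)%R}.
  have n0 : (0 < n.+1%:R^-1 :> R)%R by rewrite invr_gt0.
  suff : {ae P x, forall w, exists2 s : R, s \in `[0%R, n.+1%:R^-1%R] & (- x <
    Y s w)%R}.
    by apply: filterS => w [s sn]; rewrite ltrN2; exists s.
  apply: ae_probability1;
    first exact: (measurable_exists_gt mY cY (- x) (ltW n0)).
  rewrite -(ax _ n0).2; congr (P x _); apply/seteqP; split => w /=.
    move=> /(lt_sup_imageP cY (- x) w (ltW n0)).2.
    by rewrite /inf ltrNl image_comp.
  rewrite /inf ltrNl image_comp.
  exact: (lt_sup_imageP cY (- x) w (ltW n0)).1.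
apply: ae_eq_integral_nonmeasurable.
- exact: stopped_payoff_ge0.
- by move=> w; rewrite lee_fin f_ge0.
move/ae_foralln : up => up; move/ae_foralln : down => down.
apply: filterS3 up down (ae_start Dx) => w upw downw X0.
exact: stopped_payoff_return.
Qed.

End stopped_payoff.

(** * Successive hits and their limit *)

Section successive_hits.
Context (R : realType) d (T : measurableType d) (X : R -> T -> R).
Hypothesis mX : forall t : R, (0 <= t)%R -> measurable_fun setT (X t).
Hypothesis cX : forall w, {within `[0%R, +oo[, continuous (fun t : R => X t w)}.
Variable B : nat -> set R.
Hypothesis cB : forall k, closed (B k).

Fixpoint successive_hits (k : nat) : T -> \bar R :=
  if k is k'.+1 then debut X (successive_hits k') (B k') else cst 0.

Lemma stopping_successive_hits k : stopping_time X (successive_hits k).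
Proof.
by elim: k => [|k IHk]; [exact: stopping_time0|exact: debut_stopping].
Qed.

Lemma successive_hits_ge0 k w : 0 <= successive_hits k w.
Proof. exact: (stopping_successive_hits k).1. Qed.

Lemma nondecreasing_successive_hits w :
  {homo (fun k => successive_hits k w) : m n / (m <= n)%N >-> m <= n}.
Proof.
apply: homo_leq; [by move=> ?|by move=> ? ? ?; exact: le_trans|].
by move=> k; exact: debut_ge.
Qed.

Let Binf := \bigcap_k B k.

Lemma successive_hits_le_debut k w : successive_hits k w <= debut X (cst 0)
  Binf w.
Proof.
elim: k => [|k IHk]; first exact: debut_ge.
apply: le_ereal_inf_tmp => y [t [t0 Bt] <-] /=.
apply: debut_lb; last exact: Bt.
by apply: le_trans IHk _; apply: debut_lb.
Qed.

Hypothesis B_recurrent : forall k N, exists2 k', (N <= k')%N & B k' = B k.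

Lemma cvg_successive_hits_Binf w (s : nat -> R) (t : R) :
  (forall k, successive_hits k w = (s k)%:E) -> s @ \oo --> t ->
  debut X (cst 0) Binf w = t%:E.
Proof.
move=> hs st.
have s0 k : (0 <= s k)%R by rewrite -lee_fin -hs successive_hits_ge0.
have s_nd : {homo s : m n / (m <= n)%N >-> (m <= n)%R}.
  by move=> m n mn; rewrite -lee_fin -!hs; exact: nondecreasing_successive_hits.
have sk_le k : (s k <= t)%R.
  apply: (closed_cvg [set y | (s k <= y)%R] (@closed_ge _ (s k)) _ _ st).
  by exists k => // n /= kn; exact: s_nd.
have t0 : (0 <= t)%R by exact: le_trans (s0 0%N) (sk_le 0%N).
have cXm : continuous (fun u : R =>
  X (Num.max 0%R u) w) by exact: (continuous_maxr0 (@cX w)).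
have Bt : Binf (X t w).
  move=> k _; apply: contrapT => nB.
  have nearC : \forall n \near \oo, ~ B k (X (s n) w).
    have oC : open (~` B k) by exact: closed_openC.
    have : \forall n \near \oo, (~` B k) (X (Num.max 0 (s n))%R w).
      have := cvg_comp s _ st (cXm t); apply.
      by apply: open_nbhs_nbhs; split => //; rewrite (max_idPr t0).
    by apply: filterS => n; rewrite (max_idPr (s0 n)).
  have [N _ /= HN] := nearC.
  (* Outside the closed set [B k] the path would stay outside at all late hits, yet [B k] recurs as
     [B k']. The set [B k'] is reached at hit [k'.+1], hit [0] being time [0]. *)
  have [k' Nk' Bk'] := B_recurrent k N.
  apply: (HN k'.+1); first exact: leq_trans Nk' _.
  rewrite -Bk'; exact: (debut_attained cX (@cB k') (successive_hits_ge0 k' w)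
    (hs k'.+1)).
have dle : debut X (cst 0) Binf w <= t%:E by exact: debut_lb.
have dge := successive_hits_le_debut ^~ w.
case dE : (debut X (cst 0) Binf w) => [v| |]//; last 2 first.
- by rewrite dE in dle.
- by have := debut_ge X (cst 0) Binf w; rewrite dE.
congr EFin; apply/eqP; rewrite eq_le -lee_fin -dE dle /=.
apply: (closed_cvg [set y | (y <= v)%R] (@closed_le _ v) _ _ st).
by apply: nearW => k /=; rewrite -lee_fin -hs -dE; exact: dge.
Qed.

Context (D : set R) (f delta : R -> R).
Hypothesis XD : forall (t : R) w, (0 <= t)%R -> D (X t w).
Hypothesis cf : {within D, continuous f}.
Hypothesis delta_discount : discount_function delta.

(** Three cases. If some hit is infinite, all later values and the limit are [0]. If the hits stay
    bounded, the payoff is continuous along the path. If they are finite and unbounded, [Binf] is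
    never met and the payoff tends to [0] along the hits. *)
Lemma cvg_stopped_value_hits w :
  discounted_payoff X f delta w t @[t --> +oo%R] --> 0%R ->
  stopped_value X f delta (successive_hits k) w @[k --> \oo] -->
  stopped_value X f delta (debut X (cst 0) Binf) w.
Proof.
move=> w0.
have [fin|] := pselect (forall k, successive_hits k w < +oo); last first.
  move=> /existsNP[n /negP]; rewrite -leNgt leye_eq => /eqP hn.
  have debuty : debut X (cst 0) Binf w = +oo.
    by apply/eqP; rewrite -leye_eq -hn successive_hits_le_debut.
  rewrite {2}/stopped_value debuty; apply: cvg_near_cst.
  exists n => // k /= nk; rewrite /stopped_value.
  have := nondecreasing_successive_hits w nk.
  by rewrite hn leye_eq => /eqP ->.
pose s k := fine (successive_hits k w).
have hs k : successive_hits k w = (s k)%:E.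
  by rewrite /s fineK// ge0_fin_numE// successive_hits_ge0.
have s_nd : {homo s : m n / (m <= n)%N >-> (m <= n)%R}.
  by move=> m n mn; rewrite -lee_fin -!hs; exact: nondecreasing_successive_hits.
have s0 k : (0 <= s k)%R by rewrite -lee_fin -hs successive_hits_ge0.
rewrite (_ : (fun k => _) = fun k => discounted_payoff X f delta w (s k));
  last first.
  by apply/funext => k; rewrite /stopped_value hs.
have [[M sM]|nbd] := pselect (exists M, forall k, (s k <= M)%R).
  have scvg : cvgn s.
    by apply: nondecreasing_is_cvgn => //; exists M => _ [k _ <-].
  rewrite /stopped_value (cvg_successive_hits_Binf hs scvg).
  have t0 : (0 <= limn s)%R by apply: limr_ge => //; exact: nearW.
  rewrite -[X in _ --> discounted_payoff _ _ _ _ X](max_idPr t0).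
  rewrite (_ : (fun k => _) = fun k =>
    discounted_payoff X f delta w (Num.max 0 (s k))%R); last first.
    by apply/funext => k; rewrite (max_idPr (s0 k)).
  have cZ : continuous (fun t : R =>
    discounted_payoff X f delta w (Num.max 0%R t)).
    exact: (discounted_payoff_continuous cX XD cf delta_discount).
  exact: (cvg_comp s _ scvg (cZ (limn s))).
have s_oo : s @ \oo --> +oo%R.
  apply/cvgryPge => M.
  have [k Mk] : exists k, (M < s k)%R.
    by apply: contrapT => /forallNP h; apply: nbd; exists M => k;
      rewrite leNgt; apply/negP; exact: h.
  by exists k => // n /= kn; rewrite (le_trans (ltW Mk))// s_nd.
have debuty : debut X (cst 0) Binf w = +oo.
  case dE : (debut X (cst 0) Binf w) => [t| |]//; last first.
    by have := debut_ge X (cst 0) Binf w; rewrite dE.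
  exfalso; apply: nbd; exists t => k.
  by rewrite -lee_fin -hs -dE successive_hits_le_debut.
rewrite /stopped_value debuty.
exact: (cvg_comp s _ s_oo w0).
Qed.

End successive_hits.

(** The 2-adic valuation enumerates the naturals with each value taken infinitely often; the factor
    [3 ^ N] makes the argument large without changing the valuation. *)
Lemma logn2_recurrent m N : exists2 k, (N <= k)%N & logn 2 k = m.
Proof.
exists (2 ^ m * 3 ^ N)%N.
  by rewrite (leq_trans (ltnW (ltn_expl N (isT : 1 < 3)%N)))// leq_pmull//
    expn_gt0.
by rewrite lognM ?expn_gt0// pfactorK// lognX (_ : logn 2 3 = 0%N)// muln0
  addn0.
Qed.

(** * Equilibria and their intersection *)

Section intersection.
Context (R : realType) d (Omega : measurableType d) (D : set R)
  (P : R -> probability Omega R) (X : R -> Omega -> R) (f delta : R -> R).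
Hypothesis mD : measurable D.
Hypothesis X_markov : continuous_strong_markov D P X.
Hypothesis f_ge0 : forall x, D x -> (0 <= f x)%R.
Hypothesis cf : {within D, continuous f}.
Hypothesis delta_discount : discount_function delta.
Hypothesis hyp_b : forall x, D x ->
  {ae P x, forall w, discounted_payoff X f delta w t @[t --> +oo%R] --> 0%R}.
Let mX := csm_measurable X_markov.
Let cX := csm_continuous X_markov.
Let XD := csm_state X_markov.

Lemma equilibrium_J_le A x : equilibrium D P X f delta A -> A x ->
  J P X f delta x A <= (f x)%:E.
Proof.
move=> [_ _ AE] Ax.
have : Theta D P X f delta A x by rewrite AE.
by case=> [[_ /ltW]|[[_ ->] _]].
Qed.

Lemma equilibrium_le_J A x : equilibrium D P X f delta A -> D x -> ~ A x ->
  (f x)%:E <= J P X f delta x A.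
Proof.
move=> [_ _ AE] Dx nA; rewrite leNgt; apply/negP => Jf.
by apply: nA; rewrite -AE; left.
Qed.

(** Outside [A] this is the equilibrium inequality for [J]; inside, the debut is almost surely [0]
    and equality holds. *)
Lemma equilibrium_le_debut A C x : equilibrium D P X f delta A ->
  (forall y, D y -> A y <-> C y) -> D x ->
  (f x)%:E <= \int[P x]_w (stopped_value X f delta (debut X (cst 0) C) w)%:E.
Proof.
move=> eA AC Dx; have [Ax|nAx] := pselect (A x); last first.
  rewrite -(J_notin X_markov f_ge0 delta_discount Dx AC nAx (hyp_b Dx)).
  exact: equilibrium_le_J.
rewrite (integral_stopped_value_start X_markov f_ge0 delta_discount Dx)//.
  by move=> w; exact: debut_ge.
move=> w X0; apply/eqP; rewrite eq_le debut_ge andbT.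
by apply: debut_lb => //; rewrite X0; apply/AC.
Qed.

Hypothesis hyp_c : forall x, D x ->
  \int[P x]_w ereal_sup
    [set (discounted_payoff X f delta w t)%:E | t in `[0%R, +oo[] < +oo.
Variables (A C : nat -> set R).
Hypothesis eA : forall n, equilibrium D P X f delta (A n).
Hypothesis cC : forall n, closed (C n).
Hypothesis AC : forall n y, D y -> A n y <-> C n y.

Lemma J_bigcap_notin n x : D x -> ~ (\bigcap_n A n) x ->
  J P X f delta x (A n) <= J P X f delta x (\bigcap_n A n).
Proof.
move=> Dx nAx.
(* The index [n] comes first so that [E 1] is the value of stopping at the debut of [C n]; the
   valuation then makes every index recur. *)
pose B k := C (if k is k'.+1 then logn 2 k' else n).
have cB k : closed (B k) by exact: cC.
have Brec k N : exists2 k', (N <= k')%N & B k' = B k.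
  have [k' Nk' k'E] := logn2_recurrent (if k is k'.+1 then logn 2 k' else n) N.
  by exists k'.+1; [exact: leqW|rewrite /B k'E].
have BC : \bigcap_k B k = \bigcap_n C n.
  apply/seteqP; split => y h m _; last exact: h.
  by have [k _ <-] := logn2_recurrent m 0; exact: (h k.+1 I).
pose E k := \int[P x]_w (stopped_value X f delta (successive_hits X B k) w)%:E.
have E_nd : {homo E : i j / (i <= j)%N >-> i <= j}.
  apply: homo_leq; [by move=> ?|by move=> ? ? ?; exact: le_trans|].
  move=> k; apply: (le_integral_stopped_value_debut mD X_markov f_ge0 cf
    delta_discount) => //.
    exact: stopping_successive_hits.
  by move=> y Dy; exact: (equilibrium_le_debut (eA _) (AC _) Dy).
have JE : J P X f delta x (A n) <= E 1%N.
  (* At a point of [A n] the hitting time may exceed the debut, so [f x] is inserted between the two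
     values. *)
  have [Ax|nA] := pselect (A n x); last first.
    by rewrite (J_notin X_markov f_ge0 delta_discount Dx (AC n) nA (hyp_b Dx)).
  apply: le_trans (equilibrium_J_le (eA n) Ax) _.
  exact: (equilibrium_le_debut (eA _) (AC _) Dx).
have stau k := stopping_successive_hits cX cB k.
have Einf : E k @[k --> \oo] --> J P X f delta x (\bigcap_n A n).
  rewrite (J_notin (C := \bigcap_n C n) X_markov f_ge0 delta_discount Dx _ nAx
    (hyp_b Dx)); last first.
    by move=> y Dy; split => h m _; have := h m I => /AC; exact.
  rewrite -BC.
  pose M w := ereal_sup [set (discounted_payoff X f delta w t)%:E | t in `[0%R,
    +oo[].
  have M0 w : 0 <= M w.
    apply: le_trans (_ : (discounted_payoff X f delta w 0%R)%:E <= _).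
      by rewrite lee_fin (discounted_payoff_ge0 XD).
    by apply: ereal_sup_ubound; exists 0%R => //=; rewrite in_itv/= lexx.
  have W0 k w : (0 <= stopped_value X f delta (successive_hits X B k) w)%R.
    by apply: (stopped_value_ge0 XD) => //; exact: (stau k).1.
  have mM : measurable_fun setT M.
    apply: (measurable_ereal_sup (Y := fun t w =>
      discounted_payoff X f delta w t)).
      exact: (discounted_payoff_measurable mX delta mD XD cf).
    exact: (discounted_payoff_continuous cX XD cf delta_discount).
  have sB : stopping_time X (debut X (cst 0) (\bigcap_k B k)).
    by apply: debut_stopping => //; [exact: closed_bigI|exact: stopping_time0].
  have iM : (P x).-integrable setT M.
    apply/integrableP; split => //.
    under eq_integral => w _ do rewrite gee0_abs//.
    exact: hyp_c.
  have mW k : measurable_fun setT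
      (fun w => (stopped_value X f delta (successive_hits X B k) w)%:E).
    apply/measurable_EFinP.
    apply: (measurable_stopped_value mX cX mD XD cf delta_discount);
      first exact: (stau k).1.
    exact: (stopping_measurable mX (stau k)).
  have mWinf : measurable_fun setT
      (fun w => (stopped_value X f delta (debut X (cst 0) (\bigcap_k B k))
        w)%:E).
    apply/measurable_EFinP.
    apply: (measurable_stopped_value mX cX mD XD cf delta_discount);
      first exact: sB.1.
    exact: (stopping_measurable mX sB).
  have W_cvg : {ae P x, forall w, setT w ->
      (stopped_value X f delta (successive_hits X B k) w)%:E @[k --> \oo] -->
      (stopped_value X f delta (debut X (cst 0) (\bigcap_k B k)) w)%:E}.
    apply: filterS (hyp_b Dx) => w wcvg _; apply/cvg_EFin; first exact: nearW.
    exact: (cvg_stopped_value_hits cX cB Brec XD cf delta_discount wcvg).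
  have WM : {ae P x, forall w (k : nat), setT w ->
      `|(stopped_value X f delta (successive_hits X B k) w)%:E| <= M w}.
    apply: aeW => w k _; rewrite gee0_abs ?lee_fin//.
    have := M0 w; have := (stau k).1 w.
    rewrite /stopped_value; case: successive_hits => // t t0 _.
    by apply: ereal_sup_ubound; exists t => //=;
      rewrite in_itv/= andbT -lee_fin.
  by have [] := dominated_convergence measurableT mW mWinf W_cvg iM WM.
apply: le_trans JE _; have Elim := cvg_lim (@ereal_hausdorff R) Einf.
rewrite -Elim; apply: lime_ge; first by apply/cvg_ex; eexists; exact: Einf.
by exists 1%N => // k /= k1; exact: E_nd.
Qed.

End intersection.

Theorem proposition4p2 (R : realType) (d : measure_display)
    (Omega : measurableType d) (D : set R) (P : R -> probability Omega R)
    (X : R -> Omega -> R) (f delta : R -> R)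
    (D_interval : is_interval D)
    (X_markov : continuous_strong_markov D P X)
    (f_ge0 : forall x, D x -> (0 <= f x)%R)
    (f_continuous : {within D, continuous f})
    (delta_discount : discount_function delta)
    (hyp_a : forall x t : R, D x -> (0 < t)%R ->
      P x [set w | (x < sup [set X s w | s in `[0%R, t]])%R] = 1 /\
      P x [set w | (inf [set X s w | s in `[0%R, t]] < x)%R] = 1)
    (hyp_b : forall x, D x ->
      {ae P x, forall w, discounted_payoff X f delta w t @[t --> +oo%R] --> 0%R})
    (hyp_c : forall x, D x ->
      \int[P x]_w ereal_sup
        [set (discounted_payoff X f delta w t)%:E | t in `[0%R, +oo[] < +oo)
    (A_ : nat -> set R)
    (A_equilibrium : forall n, equilibrium D P X f delta (A_ n))
    (A_closed : forall n, closed (A_ n : set (subspace D))) :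
  equilibrium D P X f delta (\bigcap_n A_ n) /\
  (forall n x, D x ->
    J P X f delta x (A_ n) <= J P X f delta x (\bigcap_n A_ n)).
Proof.
have mD := is_interval_measurable D_interval.
have A_sub n : A_ n `<=` D by have [] := A_equilibrium n.
(* Closedness is relative to [D], whereas debuts are handled for sets closed in the line; the
   closure has the same trace on [D]. *)
have A_closure n y : D y -> A_ n y <-> closure (A_ n) y.
  move=> Dy; split; first exact: subset_closure.
  have [C cC CD] := (closed_subspaceP _ _).1 (A_closed n).
  have AC : A_ n `<=` C.
    move=> z Az; have : (A_ n `&` D) z by split => //; exact: (A_sub n).
    by rewrite -CD => -[].
  move=> /(closureS AC); rewrite -(closure_id _).1// => Cy.
  by have [] : (A_ n `&` D) y by rewrite -CD.
have JA n x : D x -> ~ (\bigcap_n A_ n) x ->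
    J P X f delta x (A_ n) <= J P X f delta x (\bigcap_n A_ n).
  apply: (J_bigcap_notin (C := fun k =>
    closure (A_ k)) mD X_markov f_ge0 f_continuous delta_discount hyp_b hyp_c
    A_equilibrium).
    by move=> k; exact: closed_closure.
  exact: A_closure.
have J_inside x : D x -> (\bigcap_n A_ n) x -> J P X f delta x (\bigcap_n A_ n)
  = (f x)%:E.
  move=> Dx Ax; apply: (J_in X_markov f_ge0 delta_discount Dx Ax) => t t0.
  exact: hyp_a.
have AD : \bigcap_n A_ n `<=` D by move=> y /(_ 0%N I); exact: (A_sub 0%N).
split.
  split => //.
    by apply: bigcapT_measurable => n; have [] := A_equilibrium n.
  apply/seteqP; split => y.
    (* A point of [S_] outside the intersection lies outside some [A_ n]; there [f] is at most the
       value for [A_ n], hence at most the value for the intersection, a contradiction. *)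
    move=> [[Dy Jf]|[_ //]]; apply: contrapT => nA.
    have /existsNP[n /not_implyP[_ nAn]] := nA.
    have := equilibrium_le_J (A_equilibrium n) Dy nAn.
    by move=> /le_trans/(_ (JA n y Dy nA)); rewrite leNgt Jf.
  by move=> Ay; right; split => //; split; [exact: AD|rewrite J_inside//;
    exact: AD].
move=> n x Dx; have [Ax|] := pselect ((\bigcap_n A_ n) x); last exact: JA.
rewrite J_inside//; apply: (equilibrium_J_le (A_equilibrium n)).
exact: Ax n I.
Qed.
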